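(* Let $K\in\mathbb R$, $N\in(0,\infty)$ and let $(X,d,m)$ be an $\mathrm{RCD}^*(K,N)$ space with heat flow $\mathcal H_t$ on $\mathcal P_2(X,d)$. Then for any $\mu,\nu\in\mathcal P_2(X,d)$ and $s,t>0$: $$\mathfrak s_{K/N}\Big(\tfrac12W_2(\mathcal H_t\mu,\mathcal H_s\nu)\Big)^2\le e^{-K(s+t)}\,\mathfrak s_{K/N}\Big(\tfrac12W_2(\mu,\nu)\Big)^2+\frac NK\big(1-e^{-K(s+t)}\big)\frac{(\sqrt t-\sqrt s)^2}{2(s+t)}.$$ This implies the slightly weaker bound $$W_2(\mathcal H_t\mu,\mathcal H_s\nu)^2\le e^{-K\tau(s,t)}\,W_2(\mu,\nu)^2+2N\,\frac{1-e^{-K\tau(s,t)}}{K\tau(s,t)}\,(\sqrt t-\sqrt s)^2,\qquad \tau(s,t)=\tfrac23\,(t+\sqrt{ts}+s).$$ In particular, for $t=s$ one has $W_2(\mathcal H_t\mu,\mathcal H_t\nu)\le e^{-Kt}\,W_2(\mu,\nu)$.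
   Context: For $K=0$ the expressions $\frac1K(1-e^{-K(s+t)})$ and $\frac{1-e^{-K\tau}}{K\tau}$ are understood as their limits $s+t$ and $1$. A metric measure space $(X,d,m)$ consists of a complete separable metric space $(X,d)$ and a locally finite, $\sigma$-finite Borel measure $m$ on $X$. $\mathcal P_2(X,d)$ is the set of Borel probability measures on $X$ with finite second moment; $W_2$ is the $L^2$-Wasserstein distance. $\mathrm{Ent}(\mu)=\int\rho\log\rho\,dm$ if $\mu=\rho m$ and $(\rho\log\rho)_+$ is $m$-integrable, and $\mathrm{Ent}(\mu)=+\infty$ otherwise; $\mathcal P_2^*(X,d,m)$ is the set of $\mu\in\mathcal P_2(X,d)$ with finite entropy; $U_N(\mu)=\exp(-\frac1N\mathrm{Ent}(\mu))$. For $\kappa\in\mathbb R$, $\theta\ge0$: $\mathfrak s_\kappa(\theta)=\frac{1}{\sqrt\kappa}\sin(\sqrt\kappa\theta)$ if $\kappa>0$, $\theta$ if $\kappa=0$, $\frac1{\sqrt{-\kappa}}\sinh(\sqrt{-\kappa}\theta)$ if $\kappa<0$. For $t\in[0,1]$: $\sigma_\kappa^{(t)}(\theta)=\mathfrak s_\kappa(t\theta)/\mathfrak s_\kappa(\theta)$ if $\kappa\theta^2\ne0$ and $\kappa\theta^2<\pi^2$; $=t$ if $\kappa\theta^2=0$; $=+\infty$ if $\kappa\theta^2\ge\pi^2$. $\mathrm{CD}^e(K,N)$: for each pair $\mu_0,\mu_1\in\mathcal P_2^*(X,d,m)$ there is a constant speed $W_2$-geodesic $(\mu_t)_{t\in[0,1]}$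 in $\mathcal P_2^*(X,d,m)$ from $\mu_0$ to $\mu_1$ such that for all $t\in[0,1]$: $U_N(\mu_t)\ge\sigma_{K/N}^{(1-t)}(W_2(\mu_0,\mu_1))\,U_N(\mu_0)+\sigma_{K/N}^{(t)}(W_2(\mu_0,\mu_1))\,U_N(\mu_1)$. Cheeger energy: for Lipschitz $f$ let $|\nabla f|(x)=\limsup_{y\to x}|f(y)-f(x)|/d(x,y)$. For $f\in L^2(X,m)$, $\mathrm{Ch}(f)=\inf\{\liminf_n\frac12\int|\nabla f_n|^2dm\}$, the infimum over all sequences of Lipschitz functions $f_n\to f$ in $L^2(X,m)$. $(X,d,m)$ is infinitesimally Hilbertian if $\mathrm{Ch}$ is a quadratic form. $\mathrm{RCD}^*(K,N)$ space: a metric measure space with $\operatorname{supp}m=X$ which is infinitesimally Hilbertian and satisfies $\mathrm{CD}^e(K,N)$. Equivalently: $(X,d)$ is a length space, $\int_Xe^{-c\,d(x_0,x)^2}dm(x)<\infty$ for all $x_0\in X,c>0$, and every $\mu\in\mathcal P_2(X,d)$ is the starting point of an $\mathrm{EVI}_{K,N}$ gradient flow of $\mathrm{Ent}$, i.e. a curve $(\mu_t)$, locally absolutely continuous on $(0,\infty)$ with values in $\{\mathrm{Ent}<\infty\}$, with $\mu_t\to\mu$ in $W_2$ as $t\to0$, such that for all $\nu$ with $\mathrm{Ent}(\nu)<\infty$ and a.e. $t>0$: $\frac{d}{dt}\mathfrak s_{K/N}(\frac12W_2(\mu_t,\nu))^2+K\mathfrak s_{K/N}(\frac12W_2(\mu_t,\nu))^2\le\frac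 N2\big(1-\frac{U_N(\nu)}{U_N(\mu_t)}\big)$. This flow is unique and the heat flow is $\mathcal H_t\mu:=\mu_t$. *)

(* Defs.v *)
From HB Require Import structures.
From mathcomp Require Import all_boot all_order all_algebra.
From mathcomp Require Import all_classical all_reals all_analysis.

Set Implicit Arguments.
Unset Strict Implicit.
Unset Printing Implicit Defensive.

Import Order.TTheory GRing.Theory Num.Theory.
Import numFieldNormedType.Exports.

Local Open Scope classical_set_scope.
Local Open Scope ring_scope.

(* [Complete] carries a base point, i.e. the space is nonempty; measurable
   types are pointed in the library anyway. *)
#[short(type="completeMetricType")]
HB.structure Definition CompleteMetric (K : numDomainType) :=
  {T of Complete T & Metric K T}.

Notation borel X := (g_sigma_algebraType (@open X)).

Section metric_measure_space.
Context {R : realType} {X : completeMetricType R}.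
Variable m : {measure set (borel X) -> \bar R}.

Definition separable := exists2 D : set X, countable D & dense D.

Definition locally_finite :=
  forall x : X, exists U : set X, [/\ open U, U x & (m U < +oo)%E].

Definition is_metric_measure_space :=
  [/\ separable, locally_finite & sigma_finite setT m].

Definition msupport : set X :=
  [set x | forall U : set X, open U -> U x -> (0 < m U)%E].

End metric_measure_space.

Section wasserstein.
Context {R : realType} (X : completeMetricType R).

Record P2 := {
  P2_prob :> probability (borel X) R ;
  P2_moment : exists x0 : X,
    (\int[P2_prob]_x (mdist x0 (x : X) ^+ 2)%:E < +oo)%E }.

(* Library measures are functions on all sets, with arbitrary values on
   non-measurable ones, so Leibniz equality is too strong. *)
Definition eq_P2 (mu nu : P2) := forall A : set (borel X),
  measurable A -> mu A = nu A.

Definition coupling (mu nu : P2) (q : probability (borel X * borel X)%type R) :=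
  forall A : set (borel X), measurable A ->
    q (A `*` setT) = mu A /\ q (setT `*` A) = nu A.

(* The infimum is finite on [P2], so [fine] loses nothing. *)
Definition W2 (mu nu : P2) : R :=
  Num.sqrt (fine (ereal_inf
    [set (\int[q]_z (mdist (z.1 : X) (z.2 : X) ^+ 2)%:E)%E
      | q in [set q | coupling mu nu q]])).

Definition W2_geodesic (gam : R -> P2) := forall s t,
  0 <= s <= 1 -> 0 <= t <= 1 ->
  W2 (gam s) (gam t) = `|t - s| * W2 (gam 0) (gam 1).

Definition W2_abs_continuous (a b : R) (gam : R -> P2) :=
  exists2 g : R -> R,
    (@lebesgue_measure R).-integrable `[a, b] (EFin \o g) &
    forall s t, a <= s -> s <= t -> t <= b ->
      ((W2 (gam s) (gam t))%:E <=
        \int[@lebesgue_measure R]_(r in `[s, t]) (g r)%:E)%E.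

End wasserstein.

Section entropy.
Context {R : realType} {X : completeMetricType R}.
Variable m : {measure set (borel X) -> \bar R}.

Definition is_density (mu : P2 X) (rho : borel X -> R) :=
  [/\ measurable_fun setT rho, (forall x, 0 <= rho x) &
    forall A : set (borel X), measurable A ->
      mu A = (\int[m]_(x in A) (rho x)%:E)%E].

(* As [ln 0 = 0] in the library, this is 0 where [rho] vanishes. *)
Definition rho_log_rho (rho : borel X -> R) : borel X -> \bar R :=
  fun x => (rho x * ln (rho x))%:E.

(* Densities are unique up to [m]-null sets, so the set below has at most one
   element; when it is empty the infimum is [+oo], as required. *)
Definition Ent (mu : P2 X) : \bar R :=
  ereal_inf [set (\int[m]_x rho_log_rho rho x)%E | rho in
    [set rho | is_density mu rho /\
      (\int[m]_x (rho_log_rho rho)^\+ x < +oo)%E]].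

Definition P2star : set (P2 X) := [set mu | Ent mu \is a fin_num].

Definition U_ (N : R) (mu : P2 X) : \bar R :=
  expeR (- (N^-1%:E * Ent mu))%E.

End entropy.

Section distortion.
Context {R : realType}.

Definition s_ (k theta : R) : R :=
  if 0 < k then sin (Num.sqrt k * theta) / Num.sqrt k
  else if k == 0 then theta
  else (expR (Num.sqrt (- k) * theta) - expR (- (Num.sqrt (- k) * theta)))
         / 2 / Num.sqrt (- k).

Definition sigma_ (k t theta : R) : \bar R :=
  if k * theta ^+ 2 == 0 then t%:E
  else if k * theta ^+ 2 < pi ^+ 2 then (s_ k (t * theta) / s_ k theta)%:E
  else +oo%E.

(* (1 - e^{-Kr}) / K, extended by continuity at K = 0 *)
Definition expdiv (K r : R) : R :=
  if K == 0 then r else (1 - expR (- K * r)) / K.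

(* (1 - e^{-Kr}) / (Kr), extended by continuity at K = 0; used for r > 0 *)
Definition expdiv_avg (K r : R) : R :=
  if K == 0 then 1 else (1 - expR (- K * r)) / (K * r).

Definition tau_ (s t : R) : R := 2 / 3 * (t + Num.sqrt (t * s) + s).

End distortion.

Section cheeger.
Context {R : realType} {X : completeMetricType R}.
Variable m : {measure set (borel X) -> \bar R}.

Definition is_lipschitz (f : X -> R) :=
  exists L : R, forall x y, `|f x - f y| <= L * mdist x y.

(* [maxe 0] only matters at isolated points, where the limsup over the
   (improper) punctured neighbourhood filter would be [-oo] instead of 0. *)
Definition lip (f : X -> R) (x : X) : \bar R :=
  maxe 0%E (limf_esup (fun y => (`|f y - f x| / mdist x y)%:E) x^').

Definition Ch (f : borel X -> R) : \bar R :=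
  ereal_inf [set limn_einf
      (fun n => (2^-1%:E * \int[m]_x (lip (F n) x ^+ 2))%E) | F in
    [set F : nat -> borel X -> R |
      (forall n, is_lipschitz (F n) /\ F n \in Lfun m 2%:E) /\
      'N[m]_2%:E[(fun x => (F n x - f x)%:E)]%E @[n --> \oo] --> 0%E]].

Definition infinitesimally_Hilbertian :=
  (forall (a : R) f, f \in Lfun m 2%:E ->
     Ch (a \*o f) = ((a ^+ 2)%:E * Ch f)%E) /\
  (forall f g, f \in Lfun m 2%:E -> g \in Lfun m 2%:E ->
     (Ch (f \+ g)%R + Ch (f \- g)%R = 2%:E * Ch f + 2%:E * Ch g)%E).

End cheeger.

Section RCD.
Context {R : realType} {X : completeMetricType R}.
Variables (K N : R) (m : {measure set (borel X) -> \bar R}).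

Definition CDe := forall mu0 mu1 : P2 X, P2star m mu0 -> P2star m mu1 ->
  exists gam : R -> P2 X,
  [/\ eq_P2 (gam 0) mu0 /\ eq_P2 (gam 1) mu1,
      forall t, 0 <= t <= 1 -> P2star m (gam t),
      W2_geodesic gam &
      forall t, 0 <= t <= 1 ->
        (sigma_ (K / N) (1 - t) (W2 mu0 mu1) * U_ m N mu0
         + sigma_ (K / N) t (W2 mu0 mu1) * U_ m N mu1
         <= U_ m N (gam t))%E].

Definition RCDstar :=
  [/\ is_metric_measure_space m, msupport m = setT,
      infinitesimally_Hilbertian m & CDe].

(* EVI flows are those of functionals with values in (-oo, +oo]; [Ent] is one
   on an RCD* space, where {Ent < +oo} therefore coincides with [P2star]. Only
   the values of [gam] at positive times matter. *)
Definition EVI_flow_from (mu : P2 X) (gam : R -> P2 X) :=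
  [/\ forall a b, 0 < a -> a < b -> W2_abs_continuous a b gam,
      forall t, 0 < t -> P2star m (gam t),
      W2 (gam t) mu @[t --> 0^'+] --> (0 : R) &
      forall nu, P2star m nu ->
        let f := fun t => s_ (K / N) (2^-1 * W2 (gam t) nu) ^+ 2 in
        {ae @lebesgue_measure R, forall t, 0 < t ->
          derivable f t 1 /\
          ((derive1 f t + K * f t)%:E <=
             (N / 2)%:E * (1 - U_ m N nu / U_ m N (gam t)))%E}].

Definition is_heat_flow (H : R -> P2 X -> P2 X) :=
  forall mu, EVI_flow_from mu (fun t => H t mu).

End RCD.

(* Main.v *)
From HB Require Import structures.
Require Import Defs.
From mathcomp Require Import all_boot all_order all_algebra.
From mathcomp Require Import all_classical all_reals all_analysis.
From mathcomp Require Import measurable_realfun.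
From mathcomp Require Import ring lra.
Set Implicit Arguments.
Unset Strict Implicit.
Unset Printing Implicit Defensive.
Import Order.TTheory GRing.Theory Num.Theory.
Import numFieldNormedType.Exports.
Local Open Scope classical_set_scope.
Local Open Scope ring_scope.

(* Let x and y be two EVI flows, run at rates a and b.  Adding the two EVI
   inequalities for s_{K/N}(W2(x_{ra}, y_{rb})/2)^2 produces the factor
   a(1 - v/u) + b(1 - u/v) <= (sqrt a - sqrt b)^2, where u and v are the values
   of U_N at the two points, and Gronwall's lemma gives the first bound.  The
   inequalities hold only almost everywhere, for a fixed reference measure, and
   the entropy is not known to be semicontinuous; so u and v are replaced by the
   right-continuous nondecreasing envelopes of U_N along x and y, for which the
   EVI inequalities hold at every time in the sense of Dini derivatives.

   For the second bound, join x_{ra} to y_{rb} by the geodesic provided by CD^e,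
   subdivide it, start a flow at each division point with a rate whose square
   root is affine along the geodesic, and apply the first bound to neighbouring
   flows for an infinitesimal time.  Summing the squares over the subdivision
   replaces a + b by twice the mean rate, which is tau(a, b).

   All this uses that W2 is a pseudometric; the triangle inequality is proved by
   gluing couplings along a countable partition into small sets, following
   Clement and Desch. *)

(** * Dini derivatives and Gronwall's lemma *)

(** The bound by (sqrt a - sqrt b)^2 is the arithmetic-geometric mean inequality a v/u + b u/v >= 2
    sqrt(a b), valid for all positive u and v. What it needs is that the number bounding [U] from
    above along one flow also serves as reference value when a point of that flow is the reference
    of the other. This is possible because the EVI inequality depends on its reference q through a
    continuous distance and the number [U q] alone: once integrated over an interval of time, it
    allows q to be moved to nearby points where [U] is large.

    The second bound needs infinitesimal times because the change of 4 s_{K/N}(W/2)^2 is close to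
    that of W^2 only while W is small. If the square root of the rate is (1 - r) sqrt a + r sqrt b
    at the fraction r of the geodesic, the mean rate is (a + sqrt(a b) + b)/3, whence the 2/3 in
    [tau_]; and the squared gaps of the square roots, summed over n pieces and multiplied by n,
    still give (sqrt a - sqrt b)^2. The geodesic is redrawn at every time, so the flows started at
    its ends have to be identified with the given ones by a local uniqueness result. *)

Section real_analysis.
Context {R : realType}.
Implicit Types (f F : R -> R).

Lemma derivable_expansion f (x : R) : derivable f x 1 ->
  forall d : R, 0 < d -> exists2 e : R, 0 < e &
    forall h : R, `|h| < e -> `|f (x + h) - f x - h * derive1 f x| <= d * `|h|.
Proof.
move=> df d d0; rewrite derive1E.
have /cvgrPdist_lt /(_ d d0) := df.
rewrite /dnbhs /within /= => -[e /= e0 He]; exists e => // h he.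
have [->|h0] := eqVneq h 0.
  by rewrite addr0 subrr mul0r subrr normr0 mulr0.
have := He h; rewrite /ball_ /= sub0r normrN => /(_ he h0).
rewrite /GRing.scale /= mulr1 -/(derive f x 1) [h + x]addrC => /ltW Hh.
rewrite (_ : _ - _ - _ = - (h * ('D_1 f x - h^-1 * (f (x + h) - f x)))); last first.
  by rewrite mulrBr mulrA divff// mul1r; ring.
by rewrite normrN normrM mulrC ler_wpM2r.
Qed.

Lemma derivable_dini_le f (t c : R) : derivable f t 1 -> derive1 f t <= c ->
  forall e n : R, 0 < e -> 0 < n ->
  exists2 h : R, 0 < h < n & f (t + h) <= f t + h * (c + e).
Proof.
move=> df fc e n e0 n0; have [m m0 Hm] := derivable_expansion df e0.
pose h := Num.min (m / 2) (n / 2).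
have h0 : 0 < h by rewrite lt_min !divr_gt0.
have hm : h <= m / 2 by rewrite ge_min lexx.
have hn : h <= n / 2 by rewrite ge_min lexx orbT.
exists h; first by rewrite h0; lra.
have hm' : h < m by lra.
have := Hm h; rewrite gtr0_norm// => /(_ hm') /(le_trans (ler_norm _)).
have : h * derive1 f t <= h * c by rewrite ler_pM2l.
lra.
Qed.

Lemma expR_expansion (d : R) : 0 < d -> exists2 e : R, 0 < e &
  forall h : R, `|h| < e -> `|expR h - 1 - h| <= d * `|h|.
Proof.
move=> d0; have dE : derivable (@expR R) 0 1 by exact: derivable_expR.
have [e e0 He] := derivable_expansion dE d0; exists e => // h /He.
by rewrite add0r expR0 derive1E derive_val expR0 mulr1.
Qed.

Lemma expR_expansion_scale (l d : R) : 0 < d -> exists2 e : R, 0 < e &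
  forall h : R, 0 < h < e -> `|expR (- l * h) - 1 + l * h| <= d * h.
Proof.
move=> d0; pose M : R := `|l| + 1.
have M0 : 0 < M by rewrite /M; have := normr_ge0 l; lra.
have [e e0 He] := expR_expansion (divr_gt0 d0 M0).
exists (e / M); first by rewrite divr_gt0.
move=> h /andP[h0 hM].
have lh : `|- l * h| <= M * h.
  by rewrite normrM normrN (gtr0_norm h0); apply: ler_wpM2r; [exact: ltW|rewrite /M lerDl].
have hM' : M * h < e by rewrite mulrC -ltr_pdivlMr.
have := He (- l * h) (le_lt_trans lh hM').
rewrite mulNr opprK => /le_trans; apply.
rewrite -mulNr; apply: le_trans (ler_wpM2l (ltW (divr_gt0 d0 M0)) lh) _.
by rewrite mulrA divfK// gt_eqF.
Qed.

Lemma expdiv_expansion (l d : R) : 0 < d -> exists2 e : R, 0 < e &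
  forall h : R, 0 < h < e -> `|expdiv l h - h| <= d * h.
Proof.
move=> d0; rewrite /expdiv; have [l0|l0] := eqVneq l 0.
  exists 1 => // h /andP[h0 _]; rewrite subrr normr0 mulr_ge0// ltW//.
have nl0 : 0 < `|l| by rewrite normr_gt0.
have [e e0 He] := expR_expansion_scale l (mulr_gt0 d0 nl0).
exists e => // h /[dup] /andP[h0 _] /He hle.
rewrite (_ : _ - h = - ((expR (- l * h) - 1 + l * h) / l)); last by field.
by rewrite normrN normrM normfV ler_pdivrMr// mulrAC.
Qed.

(** [expdiv l] is the solution of y' = 1 - l y vanishing at 0, and this is the flow property of that
    equation. It lets the comparison function of [dini_gronwall] be restarted at any time. *)
Lemma expdivD (l x y : R) :
  expdiv l (x + y) = expR (- l * y) * expdiv l x + expdiv l y.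
Proof.
rewrite /expdiv; have [->|l0] := eqVneq l 0.
  by rewrite oppr0 mul0r expR0 mul1r.
by rewrite mulrDr expRD; field.
Qed.

Lemma expdiv_ge0 (l x : R) : 0 <= x -> 0 <= expdiv l x.
Proof.
move=> x0; rewrite /expdiv; case: ifPn => // l0.
have [l1|l1|/eqP] := ltgtP l 0; last by rewrite (negbTE l0).
- rewrite ler_ndivlMr// mul0r subr_le0 -expR0 ler_expR mulr_ge0//; lra.
- rewrite ler_pdivlMr// mul0r subr_ge0 -expR0 ler_expR mulNr oppr_le0 mulr_ge0//; lra.
Qed.

Lemma continuous_expR_scale (l : R) : continuous (fun x => expR (- l * x)).
Proof.
move=> x; apply: (@continuous_comp _ _ _ (fun x => - l * x) expR).
  by apply: cvgM; [exact: cvg_cst|exact: cvg_id].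
exact: continuous_expR.
Qed.

Lemma continuous_expdiv (l : R) : continuous (expdiv l).
Proof.
have [->|l0] := eqVneq l 0.
  rewrite (_ : expdiv 0 = id); last by apply/funext => y; rewrite /expdiv eqxx.
  by move=> x; exact: cvg_id.
rewrite (_ : expdiv l = fun y => (1 - expR (- l * y)) / l); last first.
  by apply/funext => y; rewrite /expdiv (negbTE l0).
move=> x; apply: cvgM; last exact: cvg_cst.
by apply: cvgB; [exact: cvg_cst|exact: continuous_expR_scale].
Qed.

(** The supremum of the times satisfying [P] satisfies it too, by the limit hypothesis, and the step
    would exceed it if it were below [b]. The good times need not form an interval, so a step may
    jump ahead. *)
Lemma real_induction (a b : R) (P : R -> Prop) : a <= b -> P a ->
  (forall t, a <= t -> t < b -> P t -> exists2 t', t < t' <= b & P t') ->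
  (forall t, a < t -> t <= b ->
    (forall e : R, 0 < e -> exists s, [/\ a <= s, s < t, t - e < s & P s]) -> P t) ->
  P b.
Proof.
move=> ab Pa step lim.
pose S := [set t | a <= t <= b /\ P t].
have S0 : S !=set0 by exists a; rewrite /S /= lexx ab.
have ubS : ubound S b by move=> t [/andP[]].
have supS : has_sup S by split => //; exists b.
have ltau : a <= sup S by apply: ub_le_sup; [exists b|rewrite /S /= lexx ab].
have taub : sup S <= b by apply: ge_sup.
have Ptau : P (sup S).
  have [<-//|/eqP na] := pselect (a = sup S).
  have [Pt|nPt] := pselect (P (sup S)) => //.
  apply: lim => //; first by rewrite lt_neqAle na.
  move=> e e0; have [s [/andP[as_ sb] Ps] ts] := sup_adherent e0 supS.
  exists s; split => //; rewrite lt_neqAle; apply/andP; split.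
    by apply/eqP => E; apply: nPt; rewrite -E.
  by apply: ub_le_sup; [exists b|split => //; rewrite as_].
move: taub; rewrite le_eqVlt => /orP[/eqP <-//|tb].
have [t' /andP[tt' t'b] Pt'] := step _ ltau tb Ptau.
have : t' <= sup S.
  apply: ub_le_sup; first by exists b.
  by split => //; rewrite t'b (le_trans ltau (ltW tt')).
by rewrite leNgt tt'.
Qed.

(** The restriction [d <= 1] serves callers whose error constant is valid for bounded perturbations
    only. *)
Lemma ge0_le_slack (x y C : R) : 0 <= C ->
  (forall d : R, 0 < d -> d <= 1 -> x <= y + d * C) -> x <= y.
Proof.
move=> C0 H; apply/ler_addgt0Pr => e e0.
have C1 : 0 < C + 1 by lra.
pose d := Num.min 1 (e / (C + 1)).
have d0 : 0 < d by rewrite lt_min ltr01 divr_gt0.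
have d1 : d <= 1 by rewrite ge_min lexx.
have de : d <= e / (C + 1) by rewrite ge_min lexx orbT.
apply: le_trans (H d d0 d1) _; rewrite lerD2l.
apply: (@le_trans _ _ (e / (C + 1) * C)); first exact: ler_wpM2r.
by rewrite mulrAC ler_pdivrMr// ler_pM2l//; lra.
Qed.

(* Upper semicontinuity from the left together with the Dini bound, along some
   sequence decreasing to each point, is all that the comparison needs. *)
Lemma dini_gronwall F (a b l c : R) : a <= b ->
  (forall t, a < t -> t <= b -> forall e : R, 0 < e -> exists2 n : R, 0 < n &
     forall s, a <= s -> s < t -> t - n < s -> F t <= F s + e) ->
  (forall t, a <= t -> t < b -> forall d n : R, 0 < d -> 0 < n ->
     exists2 h : R, 0 < h < n & F (t + h) <= F t + h * (- l * F t + c + d)) ->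
  F b <= expR (- l * (b - a)) * F a + c * expdiv l (b - a).
Proof.
move=> ab usc dini.
pose C := expR (- l * (b - a)) + expdiv l (b - a).
have C0 : 0 <= C by rewrite addr_ge0 ?expR_ge0 ?expdiv_ge0 ?subr_ge0.
apply: (@ge0_le_slack _ _ C) => // d d0 _.
(* [B] solves B' = - l B + c + d from [F a + d], and at [b] it exceeds the claimed bound by exactly
   [d * C]. Half of the extra slope [d] is granted to the Dini bound, the other half absorbs the
   remainders of the first-order expansions. *)
pose B t := expR (- l * (t - a)) * (F a + d) + (c + d) * expdiv l (t - a).
suff : F b <= B b by rewrite /B /C => /le_trans; apply; nra.
have BD t h : B (t + h) = expR (- l * h) * B t + (c + d) * expdiv l h.
  rewrite /B (_ : t + h - a = (t - a) + h); last ring.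
  rewrite expdivD (mulrDr (- l)) expRD; ring.
apply: (@real_induction a b (fun t => F t <= B t)) => //.
- rewrite /B subrr mulr0 expR0 mul1r /expdiv mulr0 expR0 subrr mul0r if_same.
  by rewrite mulr0 addr0; lra.
- move=> t at_ tb FB.
  pose M : R := `|B t| + `|c + d| + 1.
  have M0 : 0 < M by rewrite /M; have := normr_ge0 (B t); have := normr_ge0 (c + d); lra.
  have d2 : 0 < d / 2 / M by rewrite !divr_gt0.
  have [e1 e10 He1] := expR_expansion_scale l d2.
  have [e2 e20 He2] := expdiv_expansion l d2.
  have l1 : 0 < `|l| + 1 by have := normr_ge0 l; lra.
  pose n := Num.min (Num.min e1 e2) (Num.min (b - t) (`|l| + 1)^-1).
  have n0 : 0 < n by rewrite !lt_min e10 e20 subr_gt0 tb invr_gt0.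
  have [h /andP[h0 hn] Hh] := dini t at_ tb (d / 2) n (divr_gt0 d0 (ltr0Sn _ 1)) n0.
  move: hn; rewrite !lt_min => /andP[/andP[he1 he2] /andP[hbt hl]].
  exists (t + h); first by rewrite ltrDl h0 -lerBrDl ltW.
  (* For such [h] the Euler step y -> y + h (- l y + const) is monotone, so it carries [F t <= B t]
     over to [t + h]. *)
  have lh : 0 <= 1 - l * h.
    rewrite subr_ge0; apply: le_trans (ler_norm _) _.
    rewrite normrM (gtr0_norm h0); apply: (@le_trans _ _ ((`|l| + 1) * h)).
      by rewrite ler_pM2r// lerDl.
    by rewrite mulrC -ler_pdivlMr// div1r ltW.
  have h1 := He1 h; rewrite h0 he1 in h1; have {}h1 := h1 isT.
  have h2 := He2 h; rewrite h0 he2 in h2; have {}h2 := h2 isT.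
  have HB : B t + h * (- l * B t + c + d / 2) <= B (t + h).
    rewrite BD.
    have E : - (d / 2 * h) <= (expR (- l * h) - 1 + l * h) * B t + (c + d) * (expdiv l h - h).
      rewrite lerNl; apply: le_trans (ler_norm _) _; rewrite normrN.
      apply: le_trans (ler_normD _ _) _; rewrite !normrM.
      apply: (@le_trans _ _ (d / 2 / M * h * `|B t| + `|c + d| * (d / 2 / M * h))).
        by apply: lerD; [apply: ler_wpM2r|apply: ler_wpM2l].
      rewrite (_ : d / 2 * h = d / 2 / M * h * M); last first.
        by field; rewrite gt_eqF.
      rewrite [`|c + d| * _]mulrC -mulrDr ler_wpM2l//; last by rewrite /M; lra.
      by rewrite ltW// mulr_gt0.
    move: E; lra.
  apply: le_trans HB; apply: le_trans Hh _.
  have : (F t - B t) * (1 - l * h) <= 0 by rewrite mulr_le0_ge0// subr_le0.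
  lra.
- move=> t at_ tb H; apply/ler_addgt0Pr => e e0.
  have e2 : 0 < e / 2 by lra.
  have [n1 n10 Hn1] := usc t at_ tb _ e2.
  pose g x := expR (- l * x) * (F a + d) + (c + d) * expdiv l x.
  have cg : g x @[x --> t - a] --> g (t - a).
    apply: cvgD; apply: cvgM; try exact: cvg_cst.
      exact: continuous_expR_scale.
    exact: continuous_expdiv.
  have /cvgrPdist_lt /(_ _ e2) [/= n2 n20 Hn2] := cg.
  have n0 : 0 < Num.min n1 n2 by rewrite lt_min n10.
  have [s [as_ st ts Ps]] := H _ n0.
  have ts1 : t - n1 < s.
    by apply: le_lt_trans ts; rewrite lerD2l lerN2 ge_min lexx.
  have ts2 : t - n2 < s.
    by apply: le_lt_trans ts; rewrite lerD2l lerN2 ge_min lexx orbT.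
  have h1 := Hn1 s as_ st ts1.
  have : `|B t - B s| < e / 2.
    by apply: (Hn2 (s - a)); rewrite /ball_ /= ltr_norml; apply/andP; split; lra.
  rewrite ltr_norml => /andP[]; lra.
Qed.

(** Flows are constrained at positive times only, so the initial value enters as a bound [F0] on the
    limit at 0. The bound is obtained on [r, 1], and r tends to 0. *)
Lemma dini_gronwall_01 F (F0 l c : R) :
  (forall t, 0 < t -> t <= 1 -> forall e : R, 0 < e -> exists2 n : R, 0 < n &
     forall s, 0 < s -> s < t -> t - n < s -> F t <= F s + e) ->
  (forall t, 0 < t -> t < 1 -> forall d n : R, 0 < d -> 0 < n ->
     exists2 h : R, 0 < h < n & F (t + h) <= F t + h * (- l * F t + c + d)) ->
  (forall e : R, 0 < e -> exists2 n : R, 0 < n &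
     forall t, 0 < t -> t < n -> F t <= F0 + e) ->
  F 1 <= expR (- l) * F0 + c * expdiv l 1.
Proof.
move=> usc dini start; apply/ler_addgt0Pr => e e0.
pose g r := expR (- l * r) * F0 + c * expdiv l r.
have cg : g r @[r --> (1 : R)] --> g 1.
  apply: cvgD; apply: cvgM; try exact: cvg_cst.
    exact: continuous_expR_scale.
  exact: continuous_expdiv.
have e2 : 0 < e / 2 by lra.
have /cvgrPdist_lt /(_ _ e2) [/= m m0 Hm] := cg.
(* The number exp |l| bounds every factor [expR (- l * (1 - r))] with r in (0, 1), so the tolerance
   at the start can be fixed before [r]. *)
have L0 : 0 < expR `|l| by exact: expR_gt0.
have [n n0 Hn] := start _ (divr_gt0 e2 L0).
pose r := Num.min 2^-1 (Num.min (m / 2) (n / 2)).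
have r2 : r <= 2^-1 by rewrite ge_min lexx.
have rm : r <= m / 2 by rewrite !ge_min lexx orbT.
have rn : r <= n / 2 by rewrite !ge_min lexx !orbT.
have h20 : 0 < 2^-1 :> R by rewrite invr_gt0.
have r0 : 0 < r by rewrite !lt_min h20 !divr_gt0.
have r1 : r < 1 by apply: le_lt_trans r2 _; rewrite invf_lt1 ?ltr1n.
have Fr : F 1 <= expR (- l * (1 - r)) * F r + c * expdiv l (1 - r).
  apply: dini_gronwall; first exact: ltW.
  - move=> t rt t1 e' e'0; have [k k0 Hk] := usc t (lt_trans r0 rt) t1 e' e'0.
    by exists k => // s rs; apply: Hk; exact: lt_le_trans rs.
  - by move=> t rt t1; apply: dini => //; exact: lt_le_trans rt.
have F0r : F r <= F0 + e / 2 / expR `|l| by apply: Hn => //; lra.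
have gr : `|g 1 - g (1 - r)| < e / 2.
  by apply: Hm; rewrite /ball_ /= opprB addrC subrK gtr0_norm//; lra.
have ex : expR (- l * (1 - r)) <= expR `|l|.
  rewrite ler_expR; apply: le_trans (ler_norm _) _; rewrite normrM normrN.
  by rewrite ler_piMr// ger0_norm; lra.
have h1 : expR (- l * (1 - r)) * F r <=
    expR (- l * (1 - r)) * F0 + expR (- l * (1 - r)) * (e / 2 / expR `|l|).
  by rewrite -mulrDr ler_wpM2l// expR_ge0.
have h2 : expR (- l * (1 - r)) * (e / 2 / expR `|l|) <= e / 2.
  apply: (@le_trans _ _ (expR `|l| * (e / 2 / expR `|l|))).
    by apply: ler_wpM2r => //; rewrite ltW// divr_gt0.
  by rewrite mulrC divfK// gt_eqF.
move: gr; rewrite ltr_norml /g mulr1 => /andP[].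
lra.
Qed.

End real_analysis.

(** * The functions s_k *)

Section generalized_sine.
Context {R : realType}.
Variable k : R.

Lemma s_gt0E : 0 < k ->
  s_ k = fun x => sin (Num.sqrt k * x) / Num.sqrt k.
Proof. by move=> k0; apply/funext => x; rewrite /s_ k0. Qed.

Lemma s_eq0E : k = 0 -> s_ k = id.
Proof. by move=> k0; apply/funext => x; rewrite /s_ k0 ltxx eqxx. Qed.

Lemma s_lt0E : k < 0 -> s_ k = fun x =>
  (expR (Num.sqrt (- k) * x) - expR (- (Num.sqrt (- k) * x)))
    / 2 / Num.sqrt (- k).
Proof. by move=> k0; apply/funext => x; rewrite /s_ ltNge ltW//= lt_eqF. Qed.

(** The identity sin^2 X - sin^2 Y = sin(X + Y) sin(X - Y) and its linear and hyperbolic analogues.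
    Both the Lipschitz and the quadratic estimates of the squared function are read off from this
    factorization. *)
Lemma s_sqrB (x y : R) :
  s_ k x ^+ 2 - s_ k y ^+ 2 = s_ k (x + y) * s_ k (x - y).
Proof.
have [k0|k0|k0] := ltgtP k 0; last 2 first.
- rewrite (s_gt0E k0).
  have a0 : Num.sqrt k != 0 by rewrite gt_eqF// sqrtr_gt0.
  rewrite mulrDr mulrBr sinD sinB.
  set a := Num.sqrt k in a0 *; set X := a * x; set Y := a * y.
  have hx := cos2Dsin2 X; have hy := cos2Dsin2 Y.
  rewrite !expr_div_n -mulrBl.
  transitivity ((sin X ^+ 2 * (cos Y ^+ 2 + sin Y ^+ 2)
      - (cos X ^+ 2 + sin X ^+ 2) * sin Y ^+ 2) / a ^+ 2).
    by rewrite hx hy mulr1 mul1r.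
  by field.
- by rewrite (s_eq0E k0); ring.
rewrite (s_lt0E k0).
have a0 : Num.sqrt (- k) != 0 by rewrite gt_eqF// sqrtr_gt0 oppr_gt0.
set a := Num.sqrt (- k) in a0 *.
rewrite mulrDr mulrBr !opprD opprK !expRD !expRN.
have := expR_gt0 (a * x); have := expR_gt0 (a * y).
move: (expR _) (expR _) => X Y Y0 X0.
by field; rewrite a0 !gt_eqF.
Qed.

Lemma s_expansion (d : R) : 0 < d -> exists2 e : R, 0 < e &
  forall h : R, `|h| < e -> `|s_ k h - h| <= d * `|h|.
Proof.
move=> d0; have [k0|k0|k0] := ltgtP k 0; last 2 first.
- rewrite (s_gt0E k0).
  have a0 : 0 < Num.sqrt k by rewrite sqrtr_gt0.
  set a := Num.sqrt k in a0 *.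
  have dS : derivable (@sin R) 0 1 by exact: derivable_sin.
  have [e e0 He] := derivable_expansion dS d0.
  exists (e / a); first by rewrite divr_gt0.
  move=> h hea.
  have ah : `|a * h| = a * `|h| by rewrite normrM (gtr0_norm a0).
  have := He (a * h); rewrite ah mulrC -ltr_pdivlMr// => /(_ hea).
  rewrite add0r sin0 subr0 derive1E derive_val cos0 mulr1.
  rewrite (_ : sin (a * h) / a - h = (sin (a * h) - a * h) / a); last first.
    by field; rewrite gt_eqF.
  by rewrite normrM normfV (gtr0_norm a0) ler_pdivrMr// mulrA.
- rewrite (s_eq0E k0).
  by exists 1 => // h _; rewrite subrr normr0 mulr_ge0// ltW.
rewrite (s_lt0E k0).
have a0 : 0 < Num.sqrt (- k) by rewrite sqrtr_gt0 oppr_gt0.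
set a := Num.sqrt (- k) in a0 *.
have [e e0 He] := expR_expansion d0.
exists (e / a); first by rewrite divr_gt0.
move=> h hea.
have ah : `|a * h| = a * `|h| by rewrite normrM (gtr0_norm a0).
have ahe : `|a * h| < e by rewrite ah mulrC -ltr_pdivlMr.
have h1 := He _ ahe; have := He (- (a * h)); rewrite normrN => /(_ ahe) h2.
rewrite (_ : _ - h = ((expR (a * h) - 1 - a * h) -
   (expR (- (a * h)) - 1 - - (a * h))) / (2 * a)); last by field; rewrite gt_eqF.
rewrite normrM normfV (gtr0_norm (mulr_gt0 (ltr0Sn _ 1) a0)).
rewrite ler_pdivrMr ?mulr_gt0//; apply: le_trans (ler_normB _ _) _.
apply: le_trans (lerD h1 h2) _; rewrite ah; lra.
Qed.

Lemma s_bounded (M : R) : exists C : R, forall x, `|x| <= M -> `|s_ k x| <= C.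
Proof.
have [k0|k0|k0] := ltgtP k 0; last 2 first.
- rewrite (s_gt0E k0).
  exists (Num.sqrt k)^-1 => x _.
  rewrite normrM normfV (ger0_norm (sqrtr_ge0 k)).
  by rewrite ler_piMl ?invr_ge0 ?sqrtr_ge0// ler_norml sin_geN1 sin_le1.
- by rewrite (s_eq0E k0); exists M.
rewrite (s_lt0E k0).
have a0 : 0 < Num.sqrt (- k) by rewrite sqrtr_gt0 oppr_gt0.
set a := Num.sqrt (- k) in a0 *.
exists ((expR (a * M) + expR (a * M)) / 2 / a) => x xM.
rewrite !normrM !normfV (gtr0_norm a0) (ger0_norm (ltW (ltr0Sn _ 1))).
rewrite !ler_pM2r ?invr_gt0// (le_trans (ler_normB _ _))//.
rewrite !ger0_norm ?expR_ge0//.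
have [x1 x2] : - M <= x /\ x <= M by apply/andP; rewrite -ler_norml.
apply: lerD; rewrite ler_expR; first by rewrite ler_pM2l.
by rewrite -mulrN ler_pM2l// lerNl.
Qed.

Lemma s_le_linear (M : R) : exists2 C : R, 0 <= C &
  forall x, `|x| <= M -> `|s_ k x| <= C * `|x|.
Proof.
have [C HC] := s_bounded M.
have [e e0 He] := s_expansion (@ltr01 R).
exists (Num.max 2 (C / e)); first by rewrite le_max ler0n.
move=> x xM; have [xe|xe] := ltP `|x| e.
  apply: (@le_trans _ _ (2 * `|x|)); last by rewrite ler_wpM2r// le_max lexx.
  have := He x xe; rewrite mul1r => h.
  rewrite -[s_ k x](subrK x); apply: le_trans (ler_normD _ _) _; lra.
apply: (@le_trans _ _ (C / e * `|x|)); last by rewrite ler_wpM2r// le_max lexx orbT.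
apply: le_trans (HC x xM) _; rewrite -mulrA ler_peMr//.
  exact: le_trans (normr_ge0 _) (HC x xM).
by rewrite mulrC ler_pdivlMr// mul1r.
Qed.

Lemma sqr_s_lipschitz (M : R) : exists2 C : R, 0 <= C &
  forall x y, 0 <= x <= M -> 0 <= y <= M ->
    `|s_ k (2^-1 * x) ^+ 2 - s_ k (2^-1 * y) ^+ 2| <= C * `|x - y|.
Proof.
have [C HC] := s_bounded M; have [D D0 HD] := s_le_linear M.
exists (`|C| * D); first by rewrite mulr_ge0.
move=> x y /andP[x0 xM] /andP[y0 yM].
rewrite s_sqrB normrM -mulrA.
have h1 : `|s_ k (2^-1 * x + 2^-1 * y)| <= `|C|.
  apply: le_trans (ler_norm C); apply: HC; rewrite ger0_norm; lra.
have h2 : `|2^-1 * x - 2^-1 * y| <= `|x - y|.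
  rewrite -mulrBr normrM ger0_norm ?invr_ge0//; have := normr_ge0 (x - y); lra.
apply: ler_pM => //; apply: le_trans (HD _ _) _; last exact: ler_wpM2l.
by apply: le_trans h2 _; rewrite ler_norml; apply/andP; split; lra.
Qed.

(** The comparison concerns differences, with a relative error. Comparing each square with its
    approximation separately would leave an error of order d x^2, which does not shrink with the
    time step separating [x] from [y]. *)
Lemma sqr_s_quadratic (d : R) : 0 < d -> d <= 1 -> exists2 e : R, 0 < e &
  forall x y, 0 <= y -> y <= x -> x < e ->
    (1 - d) * (x ^+ 2 - y ^+ 2) <=
      4 * (s_ k (2^-1 * x) ^+ 2 - s_ k (2^-1 * y) ^+ 2) /\
    4 * (s_ k (2^-1 * x) ^+ 2 - s_ k (2^-1 * y) ^+ 2) <=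
      (1 + d) * (x ^+ 2 - y ^+ 2).
Proof.
(* Each of the two factors is known up to a relative error d/3, and for d <= 1 the product is then
   known up to a relative error d. *)
move=> d0 d1; have d3 : 0 < d / 3 by lra.
have [e e0 He] := s_expansion d3; exists e => // x y y0 yx xe.
rewrite s_sqrB; set u := 2^-1 * x + 2^-1 * y; set v := 2^-1 * x - 2^-1 * y.
have u0 : 0 <= u by rewrite /u; lra.
have v0 : 0 <= v by rewrite /v; lra.
have ue : u < e by rewrite /u; lra.
have ve : v < e by rewrite /v; lra.
have := He u; rewrite (ger0_norm u0) => /(_ ue).
rewrite ler_norml => /andP[u1 u2].
have := He v; rewrite (ger0_norm v0) => /(_ ve).
rewrite ler_norml => /andP[v1 v2].
have -> : x ^+ 2 - y ^+ 2 = 4 * (u * v) by rewrite /u /v; field.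
have uv0 : 0 <= u * v by rewrite mulr_ge0.
have du : 0 <= (1 - d / 3) * u by rewrite mulr_ge0//; lra.
have dv : 0 <= (1 - d / 3) * v by rewrite mulr_ge0//; lra.
have U1 : (1 - d / 3) * u <= s_ k u by lra.
have U2 : s_ k u <= (1 + d / 3) * u by lra.
have V1 : (1 - d / 3) * v <= s_ k v by lra.
have V2 : s_ k v <= (1 + d / 3) * v by lra.
have L := ler_pM du dv U1 V1.
have L2 := ler_pM (le_trans du U1) (le_trans dv V1) U2 V2.
have dd : d * d <= d by rewrite ler_piMr// ltW.
have duv : d * d * (u * v) <= d * (u * v) by rewrite ler_wpM2r.
have duv0 : 0 <= d * d * (u * v) by rewrite !mulr_ge0// ltW.
have duv1 : 0 <= d * (u * v) by rewrite mulr_ge0// ltW.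
split; lra.
Qed.

End generalized_sine.

(** * Absolutely continuous functions *)

Section absolutely_continuous.
Context {R : realType}.
Notation mu := (@lebesgue_measure R).
Implicit Types (f g : R -> R) (a b c : R).

(** [I A] is the integral over [A] of |g|, with g cut off outside [a, b]. The absolute value makes
    it monotone, g being of any sign, and half-open intervals make it additive over adjacent time
    steps. *)
Lemma integral_increment_modulus (D : R -> R -> R) g a b :
  mu.-integrable `[a, b] (EFin \o g) ->
  (forall s t, a <= s -> s <= t -> t <= b ->
     ((D s t)%:E <= \int[mu]_(r in `[s, t]) (g r)%:E)%E) ->
  exists I : set R -> R,
  [/\ forall A, 0 <= I A,
      forall A B, measurable A -> measurable B -> A `&` B = set0 ->
        I (A `|` B) = I A + I B,
      forall A B, measurable A -> measurable B -> A `<=` B -> I A <= I B,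
      forall e : R, 0 < e -> exists2 d : R, 0 < d &
        forall A, measurable A -> (mu A < d%:E)%E -> I A < e &
      forall s t, a <= s -> s <= t -> t <= b -> D s t <= I `]s, t]%classic].
Proof.
move=> ig Dg; pose h := g \_ `[a, b].
have ih : mu.-integrable setT (EFin \o h).
  by rewrite -restrict_EFin; apply/integrable_restrict => //=; rewrite setTI.
have inh : mu.-integrable setT (EFin \o (fun x => `|h x|)).
  by have := integrable_abse ih.
pose I (A : set R) : R := (\int[mu]_(x in A) `|h x|)%R.
have IU A B : measurable A -> measurable B -> A `&` B = set0 ->
    I (A `|` B) = I A + I B.
  move=> mA mB /eqP AB; rewrite /I Rintegral_setU//.
  by apply: integrableS inh => //; exact: measurableU.
have I0 A : 0 <= I A by exact: Rintegral_ge0.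
exists I; split => //.
- move=> A B mA mB AB; rewrite -(setDUK AB) IU ?setDIK//; last exact: measurableD.
  by rewrite lerDl.
- move=> e /(integral_normr_continuous ih)[d [d0 Hd]].
  by exists d => // A mA Ad; exact: Hd.
- move=> s t as_ st tb; rewrite /I Rintegral_itv_obnd_cbnd; last first.
    by apply: integrableS inh.
  have sub : `[s, t] `<=` `[a, b].
    by move=> x /=; rewrite !in_itv /= => /andP[sx xt]; apply/andP; split;
      [exact: le_trans sx|exact: le_trans tb].
  have igs : mu.-integrable `[s, t] (EFin \o g) by exact: integrableS ig.
  have -> : (\int[mu]_(x in `[s, t]) `|h x|)%R = (\int[mu]_(x in `[s, t]) `|g x|)%R.
    by apply: eq_Rintegral => x /set_mem xs; rewrite /h patchE mem_set//; exact: sub.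
  apply: le_trans (le_normr_Rintegral _ igs) => //.
  apply: le_trans (ler_norm _); rewrite -lee_fin.
  apply: le_trans (Dg s t as_ st tb) _.
  by rewrite /Rintegral fineK//; exact: integrable_fin_num.
Qed.

(* The exceptional null set is enclosed in an open set [W] of small measure;
   on [W] the increments of [f] are charged to the integral of [g] over [W],
   off [W] the Dini bound applies. *)
Lemma abs_cont_nonincreasing f g a b : a <= b ->
  mu.-integrable `[a, b] (EFin \o g) ->
  (forall s t, a <= s -> s <= t -> t <= b ->
     ((f t - f s)%:E <= \int[mu]_(r in `[s, t]) (g r)%:E)%E) ->
  {ae mu, forall t, a < t < b -> forall d n : R, 0 < d -> 0 < n ->
     exists2 h : R, 0 < h < n & f (t + h) <= f t + h * d} ->
  f b <= f a.
Proof.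
move=> ab ig fg [N [mN N0 badN]].
have [I [I0 IU IS Ie fI]] :=
  @integral_increment_modulus (fun s t => f t - f s) _ _ _ ig fg.
(* The point [a] joins the exceptional set because the Dini bound is assumed only at times strictly
   after it. *)
have mNa : measurable (N `|` [set a]) by exact: measurableU.
have Na0 : mu (N `|` [set a]) = 0%E.
  by apply: null_set_setU => //; exact: lebesgue_measure_set1.
apply: (@ge0_le_slack _ _ _ (b - a + 1)) => [|d d0 _]; first by lra.
have [r r0 Hr] := Ie d d0.
have Noo : (mu (N `|` [set a]) < +oo)%E by rewrite Na0.
have [W [oW NW Or]] := lebesgue_regularity_outer mNa Noo r0.
have mW : measurable W by exact: open_measurable.
have muW : (mu W < r%:E)%E.
  have -> // : mu W = mu (W `\` (N `|` [set a])).
  rewrite -[RHS]adde0; transitivity (mu (W `\` (N `|` [set a])) +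
    mu (W `&` (N `|` [set a])))%E; first exact: measureDI.
  by congr (_ + _)%E; rewrite (setIidr NW).
have IW : I W < d by exact: Hr.
pose H t := I (`]a, t] `&` W).
have mH t : measurable (`]a, t] `&` W) by exact: measurableI.
have Hle s t : s <= t -> H s <= H t.
  move=> st; apply: IS => // x [/=]; rewrite !in_itv /= => /andP[-> xs] Wx.
  by rewrite (le_trans xs st).
have HW s t : a <= s -> s <= t -> `]s, t] `<=` W -> H t = H s + I `]s, t]%classic.
  move=> as_ st stW; rewrite /H -IU//; last first.
    apply/seteqP; split => // x [[]] /=; rewrite !in_itv /=.
    by move=> /andP[_ xs] _ /andP[sx _]; move: (lt_le_trans sx xs); rewrite ltxx.
  congr (I _); apply/seteqP; split => x /=; rewrite !in_itv /=.
    move=> [/andP[ax xt] Wx]; have [xs|sx] := leP x s.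
      by left; rewrite ax.
    by right; rewrite xt.
  move=> [[/andP[ax xs] Wx]|/andP[sx xt]].
    by rewrite ax (le_trans xs st).
  by rewrite (le_lt_trans as_ sx) xt; split => //; apply: stW; rewrite /= in_itv /= sx.
(* [H t] is the part of the integral of |g| already spent inside [W] up to time t; all of it amounts
   to less than [d]. *)
suff : f b - d * (b - a) - H b <= f a.
  have : H b <= I W by apply: IS => //; exact: subIsetr.
  lra.
apply: (@real_induction _ a b (fun t => f t - d * (t - a) - H t <= f a)) => //.
- have : 0 <= H a by exact: I0.
  rewrite subrr mulr0; lra.
- move=> t at_ tb Pt.
  have [Ot|nWt] := pselect (W t).
    have [e /= e0 He] := open_subball oW Ot.
    pose h := Num.min (b - t) (e / 2 / 2).
    have h0 : 0 < h by rewrite lt_min subr_gt0 tb !divr_gt0.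
    have hb : h <= b - t by rewrite ge_min lexx.
    have he : h <= e / 2 / 2 by rewrite ge_min lexx orbT.
    exists (t + h); first by rewrite ltrDl h0; lra.
    have tW : `]t, t + h] `<=` W.
      move=> x /=; rewrite in_itv /= => /andP[tx xh].
      have e2 : 0 < e / 2 by lra.
      apply: (He (e / 2)); rewrite /= ?sub0r ?normrN ?gtr0_norm//; first lra.
      by rewrite -ball_normE /= ltr_norml; apply/andP; split; lra.
    have tth : t <= t + h by lra.
    rewrite (HW t (t + h))//.
    have := fI t (t + h) at_ tth; rewrite -lerBrDl hb => /(_ isT) fth.
    have : 0 <= d * h by rewrite mulr_ge0// ltW.
    lra.
  have at' : a < t.
    rewrite lt_neqAle at_ andbT; apply/eqP => ta; apply: nWt; apply: NW.
    by right; rewrite /= -ta.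
  have [] := pselect (forall d n : R, 0 < d -> 0 < n ->
     exists2 h : R, 0 < h < n & f (t + h) <= f t + h * d); last first.
    move=> nd; exfalso; apply: nWt; apply: NW; left; apply: badN => /= Hd.
    by apply: nd; apply: Hd; rewrite at' tb.
  have bt : 0 < b - t by lra.
  move=> /(_ d (b - t) d0 bt)[h /andP[h0 hb] fh].
  exists (t + h); first by rewrite ltrDl h0; lra.
  have : H t <= H (t + h) by apply: Hle; lra.
  lra.
- move=> t at_ tb lim; apply/ler_addgt0Pr => e e0.
  have [n n0 Hn] := Ie e e0.
  have [s [as_ st ts Ps]] := lim n n0.
  have := fI s t as_ (ltW st) tb.
  have : I `]s, t]%classic < e.
    apply: Hn => //; rewrite lebesgue_measure_itv /= lte_fin st -EFinD lte_fin; lra.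
  have := Hle s t (ltW st).
  have : d * (s - a) <= d * (t - a) by rewrite ler_pM2l//; lra.
  lra.
Qed.

Lemma abs_cont_dini_le f g a b c : a <= b ->
  mu.-integrable `[a, b] (EFin \o g) ->
  (forall s t, a <= s -> s <= t -> t <= b ->
     ((f t - f s)%:E <= \int[mu]_(r in `[s, t]) (g r)%:E)%E) ->
  {ae mu, forall t, a < t < b -> forall d n : R, 0 < d -> 0 < n ->
     exists2 h : R, 0 < h < n & f (t + h) <= f t + h * (c + d)} ->
  f b <= f a + c * (b - a).
Proof.
move=> ab ig fg dini.
have ic : mu.-integrable `[a, b] (EFin \o (fun=> `|c|)).
  apply: continuous_compact_integrable; [exact: segment_compact|by move=> x; exact: cvg_cst].
suff : f b - c * b <= f a - c * a by lra.
apply: (@abs_cont_nonincreasing (fun t => f t - c * t)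
  (fun x => g x + `|c|) a b) => //.
- have : mu.-integrable `[a, b] ((EFin \o g) \+ (EFin \o (fun=> `|c|)%R))%E.
    exact: integrableD.
  by [].
- move=> s t as_ st tb.
  have sub : `[s, t] `<=` `[a, b].
    by move=> x /=; rewrite !in_itv /= => /andP[sx xt]; apply/andP; split;
      [exact: le_trans sx|exact: le_trans tb].
  have igs : mu.-integrable `[s, t] (EFin \o g) by exact: integrableS ig.
  have ics : mu.-integrable `[s, t] (EFin \o (fun=> `|c|)) by exact: integrableS ic.
  have -> : (\int[mu]_(r in `[s, t]) (g r + `|c|)%:E =
      \int[mu]_(r in `[s, t]) (g r)%:E + \int[mu]_(r in `[s, t]) `|c|%:E)%E.
    exact: (integralD_EFin _ igs ics).
  rewrite integral_cst//= lebesgue_measure_itv /= lte_fin.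
  rewrite (_ : _ - _ - _ = (f t - f s) + (c * s - c * t)); last ring.
  rewrite EFinD; apply: leeD; first exact: fg.
  have ccs : c * s - c * t <= `|c| * (t - s).
    rewrite (_ : c * s - c * t = (- c) * (t - s)); last ring.
    by rewrite ler_wpM2r ?subr_ge0// -normrN ler_norm.
  case: ltP => st'; first by rewrite -EFinD -EFinM lee_fin.
  have -> : s = t by apply/eqP; rewrite eq_le st.
  by rewrite subrr mule0.
- case: dini => N [mN N0 badN]; exists N; split => //.
  apply: subset_trans badN => t /=; apply: contra_not => Ht tab d n d0 n0.
  have [h hn fh] := Ht tab d n d0 n0; exists h => //; lra.
Qed.

End absolutely_continuous.

(** * EVI flows in a pseudometric space *)

Lemma ae_forall_nat {R : realType} (Q : nat -> R -> Prop) :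
  (forall n, {ae @lebesgue_measure R, forall x, Q n x}) ->
  {ae @lebesgue_measure R, forall x n, Q n x}.
Proof.
move=> H.
have := @negligible_bigcup _ _ _ (@lebesgue_measure R)
  (fun n => ~` [set x | Q n x]) H.
by apply: negligibleS => x /= /existsNP[n Qn]; exists n.
Qed.

(** * Elementary inequalities *)

Section local_estimates.
Context {R : rcfType}.

(** Here [u] and [v] stand for the new and the old distance, [f] and [g] for the corresponding
    values of [s2]. If the distance grows, then Z >= 0 and 1/(1 - dl) <= 1 + 2 dl, which is where
    [dl <= 2^-1] comes from. If it shrinks, only a negative Z matters, and 1/(1 + dl) >= 1 - dl. *)
Lemma sqr_gap_le (u v f g dl Z h : R) : 0 < dl -> dl <= 2^-1 ->
  0 <= u -> 0 <= v -> 0 < h ->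
  (v <= u -> (1 - dl) * (u ^+ 2 - v ^+ 2) <= 4 * (f - g)) ->
  (u <= v -> 4 * (g - f) <= (1 + dl) * (v ^+ 2 - u ^+ 2)) ->
  f - g <= h * Z -> u ^+ 2 - v ^+ 2 <= 4 * h * (Z + 2 * dl * `|Z|).
Proof.
move=> dl0 dl2 u0 v0 h0 H1 H2 X.
have Zp : 0 <= h * `|Z| by rewrite mulr_ge0// ltW.
have dZ : 0 <= dl * (h * `|Z|) by rewrite mulr_ge0// ltW.
have [vu|uv] := leP v u.
  have {H2}H1 := H1 vu.
  have sq : 0 <= u ^+ 2 - v ^+ 2 by rewrite subr_ge0 lerXn2r.
  have g1 : (1 - dl) * (u ^+ 2 - v ^+ 2) <= 4 * (h * Z) by lra.
  have dl1 : 0 <= 1 - dl by lra.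
  have Z0 : 0 <= h * Z.
    by rewrite -(pmulr_rge0 _ (ltr0Sn R 3)); apply: le_trans g1; rewrite mulr_ge0.
  have {}Z0 : 0 <= Z by rewrite pmulr_rge0 in Z0.
  rewrite (ger0_norm Z0) in dZ *.
  have dl3 : 0 <= 1 + 2 * dl by lra.
  have := ler_wpM2l dl3 g1.
  have dl4 : 0 <= 1 - 2 * dl by lra.
  have : 0 <= dl * (1 - 2 * dl) * (u ^+ 2 - v ^+ 2).
    by rewrite !mulr_ge0// ltW.
  clear; lra.
have {H1}H2 := H2 (ltW uv).
have sq : 0 <= v ^+ 2 - u ^+ 2 by rewrite subr_ge0 lerXn2r// ltW.
have g1 : - (4 * (h * Z)) <= (1 + dl) * (v ^+ 2 - u ^+ 2) by lra.
have [Z0|Z0] := leP 0 Z.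
  have : 0 <= h * Z by rewrite mulr_ge0// ltW.
  move: dZ sq; clear; lra.
have dl1 : 0 <= 1 - dl by lra.
have := ler_wpM2l dl1 g1.
have : 0 <= dl * dl * (v ^+ 2 - u ^+ 2) by rewrite !mulr_ge0// ltW.
rewrite (ltr0_norm Z0) in dZ *.
move: dZ; clear; lra.
Qed.

(** Replacing 4 F by D^2 in Z costs dl |K| A D^2, and 8 dl |Z| costs dl (4 |K| A D^2 + 4 N w + eta),
    since 4 F <= 2 D^2; hence the constants 5 and 4. The eighth in Z contributes eta/2, and dl eta
    is at most the other half. *)
Lemma local_rate_le (K N A w D F dl eta Z : R) : 0 < N -> 0 < A -> 0 <= w ->
  0 < dl -> dl <= 2^-1 -> 0 < eta -> 0 <= F ->
  (1 - dl) * D ^+ 2 <= 4 * F -> 4 * F <= (1 + dl) * D ^+ 2 ->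
  Z = - K * A * F + N / 2 * w + eta / 8 ->
  4 * (Z + 2 * dl * `|Z|) <= - K * A * D ^+ 2 + 2 * N * w
    + dl * (5 * `|K| * A * D ^+ 2 + 4 * N * w) + eta.
Proof.
move=> N0 A0 w0 dl0 dl2 eta0 F0 FD1 FD2 ZE.
have eta8 : 0 < eta / 8 by lra.
have KA : 0 <= `|K| * A by rewrite mulr_ge0// ltW.
have yF : - K * A * (4 * F - D ^+ 2) <= `|K| * A * (dl * D ^+ 2).
  apply: le_trans (ler_norm _) _; rewrite !normrM normrN (gtr0_norm A0).
  by rewrite ler_wpM2l// ler_norml; apply/andP; split; [move: FD1|move: FD2]; clear; lra.
have Zabs : `|Z| <= `|K| * A * F + N / 2 * w + eta / 8.
  rewrite ZE; apply: le_trans (ler_normD _ _) _; rewrite (gtr0_norm eta8) lerD2r.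
  apply: le_trans (ler_normD _ _) _; rewrite !normrM normrN (gtr0_norm A0).
  by rewrite normfV (ger0_norm F0) (ger0_norm w0) (gtr0_norm N0) (gtr0_norm (ltr0Sn _ 1)).
have F2 : `|K| * A * (4 * F) <= `|K| * A * (2 * D ^+ 2).
  rewrite ler_wpM2l//; have : 0 <= (1 - dl) * D ^+ 2.
    by rewrite mulr_ge0 ?sqr_ge0//; move: dl2; clear; lra.
  move: FD2; clear; lra.
have Z4 : dl * (4 * `|Z|) <= dl * (2 * (`|K| * A * D ^+ 2) + 2 * (N * w) + eta / 2).
  rewrite ler_pM2l//; move: Zabs F2; clear; lra.
have dle : dl * eta <= 2^-1 * eta by rewrite ler_pM2r.
move: Z4 ZE; move: yF dle eta0; clear; lra.
Qed.

(** For e = 0 the gap between the two sides is (sqrt a v - sqrt b u)^2 / (u v). For e > 0 each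
    quotient is bounded below by its tangent line in e, which yields the linear error term. *)
Lemma weighted_ratio_le (a b u v e : R) : 0 < a -> 0 < b -> 0 < u -> 0 < v ->
  0 <= e ->
  a * (1 - v / (u + e)) + b * (1 - u / (v + e)) <=
    (Num.sqrt a - Num.sqrt b) ^+ 2 + (a * v / u ^+ 2 + b * u / v ^+ 2) * e.
Proof.
move=> a0 b0 u0 v0 e0.
have shift (y z : R) : 0 < y -> 0 < z -> z / y - z / y ^+ 2 * e <= z / (y + e).
  move=> y0 z0; rewrite -subr_ge0.
  rewrite (_ : _ - _ = z * e ^+ 2 / (y ^+ 2 * (y + e))); last first.
    by field; rewrite !gt_eqF//; lra.
  by rewrite divr_ge0 ?mulr_ge0 ?sqr_ge0//; lra.
have h1 := ler_wpM2l (ltW a0) (shift u v u0 v0).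
have h2 := ler_wpM2l (ltW b0) (shift v u v0 u0).
have : a + b - (a * (v / u) + b * (u / v)) <= (Num.sqrt a - Num.sqrt b) ^+ 2.
  rewrite -subr_ge0 sqrrB (sqr_sqrtr (ltW a0)) (sqr_sqrtr (ltW b0)).
  rewrite (_ : _ - _ = (Num.sqrt a * v - Num.sqrt b * u) ^+ 2 / (u * v)).
    by rewrite divr_ge0 ?sqr_ge0// mulr_ge0// ltW.
  rewrite sqrrB !exprMn (sqr_sqrtr (ltW a0)) (sqr_sqrtr (ltW b0)) -mulr_natr.
  by field; rewrite !gt_eqF.
lra.
Qed.

Lemma sqr_sum_le (c : nat -> R) (n : nat) :
  (\sum_(i < n) c i) ^+ 2 <= n%:R * \sum_(i < n) c i ^+ 2.
Proof.
case: n => [|n]; first by rewrite !big_ord0 mul0r expr0n.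
(* With the mean [m], the claim says that the sum of the squares (c i - m)^2 is nonnegative. *)
set S := \sum_(i < _) c i; pose m := S / n.+1%:R.
have n0 : 0 < n.+1%:R :> R by rewrite ltr0Sn.
have -> : S ^+ 2 = n.+1%:R * (2 * m * S - n.+1%:R * m ^+ 2).
  by rewrite /m; field; rewrite gt_eqF.
rewrite ler_pM2l// lerBlDr.
have -> : n.+1%:R * m ^+ 2 = \sum_(i < n.+1) m ^+ 2.
  by rewrite sumr_const card_ord mulr_natl.
rewrite mulr_sumr -big_split /=; apply: ler_sum => i _.
have := sqr_ge0 (c i - m); rewrite sqrrB; lra.
Qed.

(** The main term is n times twice the integral of the squared affine interpolation between the end
    values; l^2 / 3 is the error of the trapezoidal rule. *)
Lemma trapezoid_sum_sqr (w l : R) (n : nat) :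
  \sum_(i < n) ((w + i%:R * l) ^+ 2 + (w + i.+1%:R * l) ^+ 2) =
  n%:R * (2 / 3 * (w ^+ 2 + w * (w + n%:R * l) + (w + n%:R * l) ^+ 2) + l ^+ 2 / 3).
Proof.
elim: n => [|n IH]; first by rewrite big_ord0 mul0r.
by rewrite big_ord_recr /= IH -natr1; field.
Qed.

Lemma sum_affine (A : nat -> R) (u h k1 k2 : R) (n : nat) :
  \sum_(i < n) (u + h * (k1 * A i + k2)) =
  n%:R * u + h * (k1 * \sum_(i < n) A i + n%:R * k2).
Proof.
elim: n => [|n IH]; first by rewrite !big_ord0; ring.
by rewrite !big_ord_recr /= IH -natr1; ring.
Qed.

Lemma eventually_forall_lt (n : nat) (Q : nat -> R -> Prop) :
  (forall i, (i < n)%N -> exists2 m : R, 0 < m & forall h, 0 < h -> h < m -> Q i h) ->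
  exists2 m : R, 0 < m & forall h, 0 < h -> h < m -> forall i, (i < n)%N -> Q i h.
Proof.
elim: n => [|n IH] H; first by exists 1.
have [i ni|m m0 Hm] := IH; first by apply: H; exact: ltnW.
have [m' m'0 Hm'] := H n (leqnn _).
exists (Num.min m m'); first by rewrite lt_min m0.
move=> h h0; rewrite lt_min => /andP[hm hm'] i; rewrite ltnS leq_eqVlt.
by move=> /orP[/eqP ->|ni]; [exact: Hm'|exact: Hm].
Qed.

End local_estimates.

(** * Abstract flows: a pseudometric [d] and a positive function [U] *)

Section evi_flows.
Context {R : realType} {T : Type}.
Variables (d : T -> T -> R) (P : set T) (U : T -> R) (K N : R).
Hypothesis d_ge0 : forall p q, 0 <= d p q.
Hypothesis d_refl : forall p, d p p = 0.
Hypothesis d_sym : forall p q, d p q = d q p.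
Hypothesis d_triangle : forall q p r, d p r <= d p q + d q r.
Hypothesis U_gt0 : forall p, 0 < U p.
Hypothesis N_gt0 : 0 < N.
Notation mu := (@lebesgue_measure R).

Definition s2 (p q : T) : R := s_ (K / N) (2^-1 * d p q) ^+ 2.

(** The starting time is a parameter so that a flow restarted later is again a flow, along the same
    curve. Convergence to [p] is stated through [d], the value of the curve at [tau] being
    arbitrary. *)
Record evi_flow (tau : R) (p : T) (x : R -> T) : Prop := EviFlow {
  evi_ac : forall a b, tau < a -> a < b ->
    exists2 g : R -> R, mu.-integrable `[a, b] (EFin \o g) &
      forall s t, a <= s -> s <= t -> t <= b ->
        ((d (x s) (x t))%:E <= \int[mu]_(r in `[s, t]) (g r)%:E)%E ;
  evi_dom : forall t, tau < t -> P (x t) ;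
  evi_start : forall e : R, 0 < e -> exists2 n : R, 0 < n &
    forall t, tau < t -> t < tau + n -> d (x t) p < e ;
  evi_ineq : forall q, P q -> {ae mu, forall t, tau < t ->
    derivable (fun r => s2 (x r) q) t 1 /\
    derive1 (fun r => s2 (x r) q) t + K * s2 (x t) q
      <= N / 2 * (1 - U q / U (x t))} }.

Lemma dist_lipschitz p q r : `|d p r - d q r| <= d p q.
Proof.
rewrite ler_norml; apply/andP; split.
  by have := d_triangle p q r; rewrite (d_sym q p); lra.
by have := d_triangle q p r; lra.
Qed.

Lemma s2_sym p q : s2 p q = s2 q p.
Proof. by rewrite /s2 d_sym. Qed.

Lemma s2_ge0 p q : 0 <= s2 p q.
Proof. exact: sqr_ge0. Qed.

Lemma s2_eq0 p q : d p q = 0 -> s2 p q = 0.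
Proof.
move=> h; have := s_sqrB (K / N) 0 0; rewrite subrr addr0 subrr => /esym/eqP.
by rewrite /s2 h mulr0 -expr2 => /eqP.
Qed.

Lemma s2_lipschitz (M : R) : exists2 C : R, 0 <= C &
  forall p q r, d p r <= M -> d q r <= M -> `|s2 p r - s2 q r| <= C * d p q.
Proof.
have [C C0 HC] := sqr_s_lipschitz (K / N) M.
exists C => // p q r pM qM.
apply: le_trans (HC _ _ _ _) _; rewrite ?d_ge0 ?pM ?qM//.
by rewrite ler_wpM2l// dist_lipschitz.
Qed.

Lemma s2_continuous p q : forall e : R, 0 < e -> exists2 n : R, 0 < n &
  forall p' q', d p' p < n -> d q' q < n -> `|s2 p' q' - s2 p q| < e.
Proof.
move=> e e0; have [C C0 HC] := s2_lipschitz (d p q + 2).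
have C1 : 0 < C + 1 by lra.
exists (Num.min 1 (e / 2 / (C + 1))); first by rewrite lt_min ltr01 !divr_gt0.
move=> p' q'; rewrite !lt_min => /andP[p1 pe] /andP[q1 qe].
have h1 : d p' q' <= d p q + 2.
  have := d_triangle p p' q'; have := d_triangle q p q'.
  rewrite (d_sym q q'); lra.
have h2 : d p q' <= d p q + 2.
  have := d_triangle q p q'; rewrite (d_sym q q'); lra.
have h3 : d p q <= d p q + 2 by lra.
have k1 := HC p' p q' h1 h2.
have k2 : `|s2 p q' - s2 p q| <= C * d q' q.
  by rewrite !(s2_sym p); apply: HC; rewrite d_sym.
rewrite (_ : s2 p' q' - s2 p q = (s2 p' q' - s2 p q') + (s2 p q' - s2 p q)); last by ring.
apply: le_lt_trans (ler_normD _ _) _; apply: le_lt_trans (lerD k1 k2) _.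
have l1 : C * d p' p <= C * (e / 2 / (C + 1)) by rewrite ler_wpM2l// ltW.
have l2 : C * d q' q <= C * (e / 2 / (C + 1)) by rewrite ler_wpM2l// ltW.
have l3 : (C + 1) * (e / 2 / (C + 1)) = e / 2 by field; rewrite gt_eqF.
have l4 : 0 < e / 2 / (C + 1) by rewrite !divr_gt0.
lra.
Qed.

Lemma s2_scaled_le p q : forall e : R, 0 < e -> exists2 n : R, 0 < n &
  forall p' q', d p' p < n -> d q' q < n -> - K * s2 p' q' <= - K * s2 p q + e.
Proof.
move=> e e0; have K1 : 0 < 1 + `|K| by have := normr_ge0 K; lra.
have [n n0 Hn] := s2_continuous p q (divr_gt0 e0 K1).
exists n => // p' q' pn qn.
have := Hn p' q' pn qn; rewrite ltr_pdivlMr// => hK.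
have : - K * (s2 p' q' - s2 p q) <= e.
  apply: le_trans (ler_norm _) _; rewrite normrM normrN.
  apply: le_trans (ltW hK); rewrite mulrC.
  by apply: ler_wpM2l => //; lra.
lra.
Qed.

(** * A single flow and the envelope of [U] along it *)

Section one_flow.
Variables (tau : R) (p0 : T) (x : R -> T).
Hypothesis flow : evi_flow tau p0 x.

Lemma evi_flow_continuous t : tau < t -> forall e : R, 0 < e ->
  exists2 n : R, 0 < n & forall r, t - n < r -> r < t + n -> d (x r) (x t) < e.
Proof.
move=> taut e e0.
have ta : tau < (tau + t) / 2 by lra.
have tb : (tau + t) / 2 < t + 1 by lra.
have [g ig dg] := evi_ac flow ta tb.
have [I [_ _ _ Ie dI]] := integral_increment_modulus ig dg.
have [n n0 Hn] := Ie e e0.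
pose n' := Num.min n (Num.min 1 ((t - tau) / 2)).
have n1 : n' <= n by rewrite ge_min lexx.
have n2 : n' <= 1 by rewrite !ge_min lexx orbT.
have n3 : n' <= (t - tau) / 2 by rewrite !ge_min lexx !orbT.
exists n'; first by rewrite !lt_min n0 ltr01; lra.
move=> r r1 r2.
have small s s' : s < s' -> s' - s < n -> I `]s, s']%classic < e.
  move=> ss' sn.
  by apply: Hn => //; rewrite lebesgue_measure_itv /= lte_fin ss' -EFinD lte_fin.
have [rt|tr|->] := ltgtP r t; last by rewrite d_refl.
- have r3 : (tau + t) / 2 <= r by lra.
  have r4 : t <= t + 1 by lra.
  by apply: le_lt_trans (dI _ _ r3 (ltW rt) r4) _; apply: small => //; lra.
- have r3 : (tau + t) / 2 <= t by lra.
  have r4 : r <= t + 1 by lra.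
  rewrite d_sym.
  by apply: le_lt_trans (dI _ _ r3 (ltW tr) r4) _; apply: small => //; lra.
Qed.

Lemma evi_flow_bounded a b q : tau < a -> a <= b ->
  exists M : R, forall r, a <= r -> r <= b -> d (x r) q <= M.
Proof.
move=> ta ab; have ab1 : a < b + 1 by lra.
have [g ig dg] := evi_ac flow ta ab1.
have [I [_ _ IS _ dI]] := integral_increment_modulus ig dg.
exists (I `]a, b + 1]%classic + d (x a) q) => r ar rb.
apply: le_trans (d_triangle (x a) _ _) _; rewrite lerD2r d_sym.
have rb1 : r <= b + 1 by lra.
apply: le_trans (dI _ _ (lexx a) ar rb1) _; apply: IS => // y /=.
by rewrite !in_itv /= => /andP[-> yr]; exact: le_trans yr rb1.
Qed.

(** The EVI inequality integrated in time, with its coefficients frozen at upper bounds. The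
    exceptional null set, which depends on [q], disappears here, so that [q] may be varied
    afterwards. *)
Lemma evi_increment q a b (u k : R) : P q -> tau < a -> a <= b -> 0 < u ->
  (forall r, a < r -> r < b -> U (x r) <= u) ->
  (forall r, a < r -> r < b -> - K * s2 (x r) q <= k) ->
  s2 (x b) q <= s2 (x a) q + (N / 2 * (1 - U q / u) + k) * (b - a).
Proof.
move=> Pq ta; rewrite le_eqVlt => /orP[/eqP<-|ab] u0 Uu Kk.
  by rewrite subrr mulr0 addr0.
have [g ig dg] := evi_ac flow ta ab.
have [M HM] := evi_flow_bounded q ta (ltW ab).
have [C C0 HC] := s2_lipschitz M.
apply: (@abs_cont_dini_le _ (fun r => s2 (x r) q) (fun r => C * g r)) => //.
- exact: ltW.
- exact: (integrableZl _ C ig).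
- move=> s t as_ st tb.
  have sub : `[s, t] `<=` `[a, b].
    by move=> y /=; rewrite !in_itv /= => /andP[sx xt]; apply/andP; split;
      [exact: le_trans sx|exact: le_trans tb].
  have igs : mu.-integrable `[s, t] (EFin \o g) by exact: integrableS ig.
  under eq_integral do rewrite EFinM.
  rewrite integralZl//.
  apply: (@le_trans _ _ (C%:E * (d (x s) (x t))%:E)%E).
    rewrite -EFinM lee_fin (le_trans (ler_norm _))// d_sym.
    by apply: HC; apply: HM => //; [exact: le_trans as_ st|exact: le_trans st tb].
  by apply: lee_wpmul2l; rewrite ?lee_fin//; exact: dg.
- case: (evi_ineq flow Pq) => A [mA A0 badA]; exists A; split => //.
  apply: subset_trans badA => t /=; apply: contra_not => Ht /andP[at_ tb] e n e0 n0.
  have [dt ineq] := Ht (lt_trans ta at_).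
  apply: (derivable_dini_le dt) => //.
  have Ux := Uu t at_ tb; have Kx := Kk t at_ tb.
  have : U q / u <= U q / U (x t) by rewrite ler_pM2l ?U_gt0// lef_pV2 ?posrE.
  move/(ler_wpM2l (ltW (divr_gt0 N_gt0 (ltr0Sn _ 1)))).
  lra.
Qed.

(* [U] is not assumed semicontinuous; what survives in the limit is a lower
   bound of the limsup of [U] at [z]. *)
Definition limsup_ge (z : T) (v : R) :=
  forall e : R, 0 < e -> exists2 q, P q & d q z < e /\ v - e < U q.

(** The inequality is applied at points q near [z] with [U q] close to [v]; everything else in it
    depends continuously on q. *)
Lemma evi_increment_limsup z v a b (u k : R) : limsup_ge z v ->
  tau < a -> a <= b -> 0 < u ->
  (forall r, a < r -> r < b -> U (x r) <= u) ->
  (forall r, a < r -> r < b -> - K * s2 (x r) z <= k) ->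
  s2 (x b) z <= s2 (x a) z + (N / 2 * (1 - v / u) + k) * (b - a).
Proof.
move=> zv ta ab u0 Uu Kk.
have [M HM] := evi_flow_bounded z ta ab.
have [C C0 HC] := s2_lipschitz (M + 1).
(* Moving the reference by e costs C e at each end of the interval, e/u in the ratio, and |K| C e in
   the bound [k]. *)
apply: (@ge0_le_slack _ _ _ (2 * C + (N / 2 / u + `|K| * C) * (b - a))).
  rewrite addr_ge0 ?mulr_ge0 ?subr_ge0//.
  by rewrite addr_ge0 ?mulr_ge0 ?invr_ge0//; exact: ltW.
move=> e e0 e1; have [q Pq [qz vq]] := zv e e0.
have close r : a <= r -> r <= b -> `|s2 (x r) q - s2 (x r) z| <= C * e.
  move=> ar rb; rewrite !(s2_sym (x r)).
  have h := HM r ar rb.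
  apply: le_trans (HC _ _ _ _ _) _.
  - have := d_triangle z q (x r); rewrite (d_sym z); lra.
  - rewrite d_sym; lra.
  - by rewrite ler_wpM2l// ltW.
have close' r : a <= r -> r <= b ->
    s2 (x r) q <= s2 (x r) z + C * e /\ s2 (x r) z <= s2 (x r) q + C * e.
  by move=> ar rb; have := close r ar rb; rewrite ler_norml => /andP[]; split; lra.
have inc : s2 (x b) q <= s2 (x a) q +
    (N / 2 * (1 - U q / u) + (k + `|K| * C * e)) * (b - a).
  apply: evi_increment => // r ar rb.
  have := Kk r ar rb.
  have : - K * (s2 (x r) q - s2 (x r) z) <= `|K| * (C * e).
    apply: le_trans (ler_norm _) _; rewrite normrM normrN ler_wpM2l//.
    by apply: close; exact: ltW.
  lra.
have [_ b2] := close' b ab (lexx b).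
have [a1 _] := close' a (lexx a) ab.
have Uv : v / u - e / u <= U q / u.
  by rewrite -mulrBl ler_pM2r ?invr_gt0// ltW.
have N2 : 0 <= N / 2 * (b - a) by rewrite mulr_ge0 ?subr_ge0// divr_ge0// ltW.
have := ler_wpM2l N2 Uv.
lra.
Qed.

(** A weak form of the growth of [U] along a flow. If U <= c just after [t], let [al] be the
    supremum of the times in [s, t] with U >= c2 = U (x s). After [al] one has U <= c2, so with
    reference [x al] the right-hand side of the EVI inequality is nonpositive and the flow stays at
    [s2] zero from [x al]. Just after [t], where U <= c < c2, the same inequality would then make
    [s2] negative. *)
Lemma evi_limsup_monotone s t c n : tau < s -> s < t -> c < U (x s) -> 0 < n ->
  exists2 r, t < r < t + n & c < U (x r).
Proof.
move=> ts st cU n0; apply: contrapT => none.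
have Uc r : t < r -> r < t + n -> U (x r) <= c.
  by move=> tr rn; rewrite leNgt; apply/negP => cUr; apply: none; exists r; rewrite ?tr.
set c2 := U (x s) in cU *.
have c0 : 0 < c.
  by apply: lt_le_trans (Uc (t + n / 2) _ _); rewrite ?U_gt0//; lra.
pose S := [set r | s <= r <= t /\ c2 <= U (x r)].
have supS : has_sup S.
  split; first by exists s; split; rewrite ?lexx ?ltW.
  by exists t => r [/andP[]].
pose al := sup S.
have sal : s <= al.
  by apply: ub_le_sup; [exact: supS.2|split; rewrite ?lexx ?ltW].
have alt : al <= t by apply: ge_sup; [exact: supS.1|move=> r [/andP[]]].
have tal : tau < al by exact: lt_le_trans ts sal.
have Hat : limsup_ge (x al) c2.
  move=> e e0; have [m m0 Hm] := evi_flow_continuous tal e0.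
  have [r [/andP[sr rt] c2r] alr] := sup_adherent m0 supS.
  exists (x r); first by apply: (evi_dom flow); exact: lt_le_trans ts sr.
  split; last by lra.
  apply: Hm => //; have : r <= al by apply: ub_le_sup; [exact: supS.2|rewrite /S /= sr rt].
  lra.
have Ual r : al < r -> r < t + n -> U (x r) <= c2.
  move=> ar rn; have [rt|tr] := leP r t; last first.
    by apply: le_trans (Uc r tr rn) _; exact: ltW.
  rewrite leNgt; apply/negP => c2r.
  have : r <= al.
    apply: ub_le_sup; first exact: supS.2.
    by split; [rewrite rt andbT; lra|exact: ltW].
  by rewrite leNgt ar.
have zero b : al <= b -> b < t + n -> s2 (x b) (x al) = 0.
  move=> ab bn; apply/eqP; rewrite eq_le s2_ge0 andbT.
  have -> : 0 = expR (- K * (b - al)) * s2 (x al) (x al) + 0 * expdiv K (b - al).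
    by rewrite s2_eq0// mulr0 mul0r addr0.
  apply: (@dini_gronwall _ (fun r => s2 (x r) (x al))) => //.
  - move=> r alr rb e e0.
    have [m m0 Hm] := s2_continuous (x r) (x al) e0.
    have [l l0 Hl] := evi_flow_continuous (lt_trans tal alr) m0.
    exists l => // y aly yr ry.
    have := Hm (x y) (x al) (Hl y ry _); rewrite d_refl => /(_ _ m0).
    by rewrite ltr_norml => h; have /andP[] := h ltac:(lra); lra.
  - move=> r alr rb e m e0 m0.
    have [l l0 Hl] := s2_scaled_le (x r) (x al) e0.
    have tr : tau < r by exact: lt_le_trans tal alr.
    have [j j0 Hj] := evi_flow_continuous tr l0.
    pose h := Num.min (m / 2) (Num.min (j / 2) (b - r)).
    have h0 : 0 < h by rewrite !lt_min !divr_gt0//= subr_gt0.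
    have hm : h <= m / 2 by rewrite ge_min lexx.
    have hj : h <= j / 2 by rewrite !ge_min lexx orbT.
    have hb : h <= b - r by rewrite !ge_min lexx !orbT.
    exists h; first by rewrite h0; lra.
    have rh : r <= r + h by lra.
    have c20 : 0 < c2 by exact: lt_trans cU.
    have := @evi_increment_limsup (x al) c2 r (r + h) c2 (- K * s2 (x r) (x al) + e)
      Hat tr rh c20.
    rewrite divff ?gt_eqF// subrr mulr0 add0r addr0 [r + h]addrC addrK [h * _]mulrC addrC.
    apply.
      by move=> y ry yh; apply: Ual; lra.
    move=> y ry yh.
    by apply: Hl; [apply: Hj; lra|rewrite d_refl].
have t1 : tau < t + n / 3 by lra.
have t2 : t + n / 3 <= t + n / 2 by lra.
have := @evi_increment_limsup (x al) c2 (t + n / 3) (t + n / 2) c 0 Hat t1 t2 c0.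
rewrite !zero ?add0r; try lra.
have E r : t + n / 3 < r -> r < t + n / 2 -> U (x r) <= c by move=> *; apply: Uc; lra.
move=> /(_ E) H.
have : 0 <= (N / 2 * (1 - c2 / c) + 0) * (t + n / 2 - (t + n / 3)).
  apply: H => r r1 r2; rewrite zero ?mulr0//; lra.
rewrite addr0 pmulr_lge0; last by lra.
rewrite pmulr_rge0 ?divr_gt0// subr_ge0 ler_pdivrMr// mul1r leNgt cU.
by [].
Qed.

(* If [U] were unbounded, the inequality against [x s] with [U (x s)] large
   would force an infinite speed at almost every time. *)
Lemma evi_locally_bounded t : tau < t ->
  exists M : R, forall r, t < r -> r < t + 1 -> U (x r) <= M.
Proof.
move=> taut; apply: contrapT => unb.
have unb_nat n : exists s, t < s < t + 1 /\ n%:R < U (x s).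
  apply: contrapT => bd; apply: unb; exists n%:R => r tr r1.
  by rewrite leNgt; apply/negP => nU; apply: bd; exists r; rewrite tr r1.
have /choice [s Hs] := unb_nat.
have tt1 : t < t + 1 by lra.
have [g ig dg] := evi_ac flow taut tt1.
have [I [I0 IU IS _ dI]] := integral_increment_modulus ig dg.
have dM r r' : t <= r -> r <= t + 1 -> t <= r' -> r' <= t + 1 ->
    d (x r) (x r') <= I `]t, t + 1]%classic.
  wlog rr' : r r' / r <= r'.
    move=> W; have [rr'|/ltW r'r] := leP r r'; first exact: W.
    by rewrite d_sym => *; exact: W.
  move=> tr r1 tr' r1'; apply: le_trans (dI _ _ tr rr' r1') _; apply: IS => // y /=.
  by rewrite !in_itv /= => /andP[ry yr]; rewrite (le_lt_trans tr ry) (le_trans yr).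
have [C C0 HC] := s2_lipschitz (I `]t, t + 1]%classic).
(* The index n of the reference [x (s n)] has to depend on the time r, so one function must control
   all of them: the increments of every [s2 (x r) (x (s n))] are bounded by those of - G. Hence G
   inherits each of their decay rates, and G would fall by any given amount M over a unit of
   time. *)
pose G r := - (C * I `]t, r]%classic).
have GD r h : t <= r -> 0 <= h -> G (r + h) = G r - C * I `]r, r + h]%classic.
  move=> tr h0; rewrite /G.
  have -> : `]t, r + h]%classic = `]t, r]%classic `|` `]r, r + h]%classic.
    apply/seteqP; split => y /=; rewrite !in_itv /=.
      by move=> /andP[ty yh]; have [yr|ry] := leP y r; [left|right]; rewrite ?ty ?yh.
    move=> [/andP[-> yr]|/andP[ry ->]]; last by rewrite (le_lt_trans tr ry).
    by rewrite (le_trans yr)// lerDl.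
  rewrite IU//; first ring.
  apply/seteqP; split => // y [] /=; rewrite !in_itv /= => /andP[_ yr] /andP[ry _].
  by move: (lt_le_trans ry yr); rewrite ltxx.
suff unbG M : G (t + 1) <= G t - M.
  have := unbG (G t - G (t + 1) + 1); lra.
rewrite (_ : G t - M = G t + (- M) * (t + 1 - t)); last by ring.
have ae_all : {ae mu, forall r, forall n, tau < r ->
    derivable (fun r => s2 (x r) (x (s n))) r 1 /\
    derive1 (fun r => s2 (x r) (x (s n))) r + K * s2 (x r) (x (s n))
      <= N / 2 * (1 - U (x (s n)) / U (x r))}.
  apply: ae_forall_nat => n.
  have [/andP[ts _] _] := Hs n.
  exact: (evi_ineq flow (evi_dom flow (lt_trans taut ts))).
apply: (@abs_cont_dini_le _ G (fun=> 0)); first exact: ltW.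
- by apply: continuous_compact_integrable; [exact: segment_compact|move=> y; exact: cvg_cst].
- move=> r r' tr rr' _; rewrite integral0 lee_fin subr_le0.
  have -> : r' = r + (r' - r) by rewrite addrC subrK.
  by rewrite GD ?subr_ge0// lerBlDr lerDl mulr_ge0.
- case: ae_all => A [mA A0 badA]; exists A; split => //.
  apply: subset_trans badA => r /=; apply: contra_not => Hr /andP[tr r1] e m e0 m0.
  have Ur := U_gt0 (x r).
  (* A reference with U > n, for n this large, brings the right-hand side of EVI below N/2 - |B|.
     The terms of [B] pay for N/2, for K [s2], and for the wanted slope - M. *)
  pose B := M + `|K| * C * I `]t, t + 1]%classic + N / 2.
  have [n Bn] : exists n : nat, `|B| * U (x r) * 2 / N < n%:R.
    eexists; apply: archi_boundP.
    by rewrite divr_ge0 ?(ltW N_gt0)// !mulr_ge0// ltW.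
  have [/andP[ts s1] nU] := Hs n.
  have [dr ineq] := Hr n (lt_trans taut tr).
  pose f r := s2 (x r) (x (s n)).
  have dfM : derive1 f r <= - M.
    have : N / 2 * (1 - U (x (s n)) / U (x r)) <= N / 2 - `|B|.
      rewrite mulrBr mulr1 lerD2l lerN2 mulrA ler_pdivlMr//.
      have := lt_trans Bn nU; rewrite ltr_pdivrMr//; lra.
    have : - (K * f r) <= `|K| * C * I `]t, t + 1]%classic.
      apply: le_trans (ler_norm _) _; rewrite normrN normrM -mulrA ler_wpM2l//.
      have := HC (x r) (x (s n)) (x (s n)).
      rewrite (s2_eq0 (d_refl (x (s n)))) subr0 d_refl => H.
      have Hd : d (x r) (x (s n)) <= I `]t, t + 1]%classic.
        by apply: dM; exact: ltW.
      by apply: le_trans (H Hd (I0 _)) _; exact: ler_wpM2l.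
    have := ler_norm B; rewrite {1}/B.
    have : derive1 f r + K * f r <= N / 2 * (1 - U (x (s n)) / U (x r)) by exact: ineq.
    lra.
  have m1 : 0 < Num.min m (t + 1 - r) by rewrite lt_min m0; lra.
  have [h /andP[h0 hm] fh] := derivable_dini_le dr dfM e0 m1.
  move: hm; rewrite lt_min => /andP[hm hr].
  exists h; first by rewrite h0.
  have rh : r + h <= t + 1 by lra.
  have rrh : r <= r + h by lra.
  have fG : `|f (r + h) - f r| <= C * I `]r, r + h]%classic.
    have rt : t <= r by exact: ltW.
    have st : t <= s n by exact: ltW.
    have r1' : r <= t + 1 by exact: ltW.
    have trh : t <= r + h by exact: le_trans rt rrh.
    apply: le_trans (HC _ _ _ _ _) _; [exact: dM st (ltW s1)|exact: dM st (ltW s1)|].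
    by rewrite ler_wpM2l// d_sym dI.
  rewrite GD; [|exact: ltW|exact: ltW].
  move: fG; rewrite ler_norml => /andP[fG _].
  move: fh; rewrite -/(f (r + h)) -/(f r); lra.
Qed.

(* The value at [t] of the right-continuous nondecreasing envelope of [U] along
   the flow. *)
Lemma evi_envelope t : tau < t -> exists u : R, [/\ 0 < u,
  forall t', t <= t' -> limsup_ge (x t') u &
  forall e : R, 0 < e -> exists2 n : R, 0 < n &
    forall r, t < r -> r < t + n -> U (x r) <= u + e].
Proof.
move=> taut.
(* The infimum of [S] is the limsup of U (x r) as r decreases to t. It is positive because
   [evi_limsup_monotone] bounds it below by the value of U at an earlier time. *)
pose S := [set M : R | exists2 n : R, 0 < n &
  forall r, t < r -> r < t + n -> U (x r) <= M].
have [M0 HM0] := evi_locally_bounded taut.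
have S0 : S !=set0 by exists M0; exists 1.
pose s0 := (tau + t) / 2.
have ts0 : tau < s0 by rewrite /s0; lra.
have s0t : s0 < t by rewrite /s0; lra.
have lbS : lbound S (U (x s0)).
  move=> M [n n0 HM]; rewrite leNgt; apply/negP => cU.
  have [r /andP[tr rn]] := evi_limsup_monotone ts0 s0t cU n0.
  by rewrite ltNge HM.
have infS : has_inf S by split => //; exists (U (x s0)).
have uS : U (x s0) <= inf S by apply: lb_le_inf.
have above c n : c < inf S -> 0 < n -> exists2 r, t < r < t + n & c < U (x r).
  move=> cS n0; apply: contrapT => none.
  have : inf S <= c.
    apply: ge_inf; first exact: infS.2.
    exists n => // r tr rn; rewrite leNgt; apply/negP => cU.
    by apply: none; exists r; rewrite ?tr.
  by rewrite leNgt cS.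
exists (inf S); split.
- exact: lt_le_trans uS.
- move=> t' tt' e e0.
  have taut' : tau < t' by exact: lt_le_trans tt'.
  have [m m0 Hm] := evi_flow_continuous taut' e0.
  have cS : inf S - e < inf S by lra.
  have [r /andP[tr rm] cU] : exists2 r, t' < r < t' + m & inf S - e < U (x r).
    move: tt'; rewrite le_eqVlt => /orP[/eqP <-|tt']; first exact: above.
    have [r /andP[tr rt'] cU] := above _ (t' - t) cS ltac:(lra).
    by apply: (@evi_limsup_monotone r t') => //; [exact: lt_trans tr|lra].
  exists (x r); first by apply: (evi_dom flow); lra.
  by split => //; apply: Hm; lra.
- move=> e e0; have [M [n n0 HM] Me] := inf_adherent e0 infS.
  by exists n => // r tr rn; apply: le_trans (HM r tr rn) (ltW Me).
Qed.

End one_flow.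

(** * Two flows run at different rates *)

Section two_flows.
Variables (tau1 tau2 : R) (p q : T) (x y : R -> T).
Hypothesis flowx : evi_flow tau1 p x.
Hypothesis flowy : evi_flow tau2 q y.

(** The flows move in turn: [y] with reference [x t], then [x] with reference [y (s + h * b)]. The
    value [v] found at time [s] may still be used at the later reference because [evi_envelope]
    provides it at all times from [s] on. *)
Lemma evi_diagonal_dini (a b t s : R) : 0 < a -> 0 < b -> tau1 < t -> tau2 < s ->
  forall e n : R, 0 < e -> 0 < n -> exists2 h : R, 0 < h < n &
    s2 (x (t + h * a)) (y (s + h * b)) <= s2 (x t) (y s) +
      h * (- (K * (a + b)) * s2 (x t) (y s)
           + N / 2 * (Num.sqrt a - Num.sqrt b) ^+ 2 + e).
Proof.
move=> a0 b0 tt ts e0 n e00 n0.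
have [u [u0 xu Uu]] := evi_envelope flowx tt.
have [v [v0 yv Uv]] := evi_envelope flowy ts.
(* The total coefficient of the slack e: the first term comes from [weighted_ratio_le], a + b from
   the two bounds on - K [s2]. *)
pose B := N / 2 * (a * v / u ^+ 2 + b * u / v ^+ 2) + a + b.
have B0 : 0 < B.
  rewrite /B -addrA ltr_wpDl ?addr_gt0// mulr_ge0//; first by rewrite divr_ge0// ltW.
  by rewrite addr_ge0// divr_ge0 ?sqr_ge0// mulr_ge0 ?ltW.
pose e := e0 / B.
have ep : 0 < e by rewrite divr_gt0.
have [m m0 Hm] := s2_scaled_le (x t) (y s) ep.
have [nx nx0 Hx] := evi_flow_continuous flowx tt m0.
have [ny ny0 Hy] := evi_flow_continuous flowy ts m0.
have [lx lx0 Ux] := Uu e ep.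
have [ly ly0 Uy] := Uv e ep.
pose M := Num.min (Num.min nx lx) (Num.min ny ly).
have M0 : 0 < M by rewrite !lt_min nx0 lx0 ny0 ly0.
have Mnx : M <= nx by rewrite !ge_min lexx.
have Mlx : M <= lx by rewrite !ge_min lexx !orbT.
have Mny : M <= ny by rewrite !ge_min lexx !orbT.
have Mly : M <= ly by rewrite !ge_min lexx !orbT.
pose h := Num.min (n / 2) (M / 2 / (a + b)).
have h0 : 0 < h by rewrite lt_min !divr_gt0// addr_gt0.
have hn : h <= n / 2 by rewrite ge_min lexx.
have hab : h * (a + b) <= M / 2.
  by rewrite -ler_pdivlMr ?addr_gt0// ge_min lexx orbT.
have ha0 : 0 < h * a by rewrite mulr_gt0.
have hb0 : 0 < h * b by rewrite mulr_gt0.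
have ha : h * a < M by lra.
have hb : h * b < M by lra.
exists h; first by rewrite h0; lra.
have tha : t < t + h * a by rewrite ltrDl.
have shb : s < s + h * b by rewrite ltrDl.
have nearx r : t <= r -> r < t + h * a -> t - nx < r /\ r < t + nx.
  move=> tr rt; split; first by rewrite (lt_le_trans _ tr)// gtrDl oppr_lt0.
  by rewrite (lt_trans rt)// ltrD2l (lt_le_trans ha).
have neary r : s <= r -> r <= s + h * b -> s - ny < r /\ r < s + ny.
  move=> sr rs; split; first by rewrite (lt_le_trans _ sr)// gtrDl oppr_lt0.
  by rewrite (le_lt_trans rs)// ltrD2l (lt_le_trans hb).
have step1 : s2 (x (t + h * a)) (y (s + h * b)) <= s2 (x t) (y (s + h * b)) +
    (N / 2 * (1 - v / (u + e)) + (- K * s2 (x t) (y s) + e)) * (h * a).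
  have := @evi_increment_limsup _ _ _ flowx (y (s + h * b)) v t (t + h * a)
    (u + e) (- K * s2 (x t) (y s) + e).
  rewrite [t + _]addrC addrK -[_ + t]addrC; apply => //.
  - by apply: yv; exact: ltW.
  - exact: ltW.
  - exact: addr_gt0.
  - move=> r tr rt; apply: Ux => //.
    by rewrite (lt_trans rt)// ltrD2l (lt_le_trans ha).
  - move=> r /ltW tr rt; have [r1 r2] := nearx r tr rt.
    have [s1 s1'] := neary _ (ltW shb) (lexx _).
    by apply: Hm; [exact: Hx|exact: Hy].
have step2 : s2 (x t) (y (s + h * b)) <= s2 (x t) (y s) +
    (N / 2 * (1 - u / (v + e)) + (- K * s2 (x t) (y s) + e)) * (h * b).
  have := @evi_increment_limsup _ _ _ flowy (x t) u s (s + h * b)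
    (v + e) (- K * s2 (x t) (y s) + e).
  rewrite [s + _]addrC addrK -[_ + s]addrC !(s2_sym (x t)); apply => //.
  - exact: xu.
  - exact: ltW.
  - exact: addr_gt0.
  - move=> r sr rs; apply: Uy => //.
    by rewrite (lt_trans rs)// ltrD2l (lt_le_trans hb).
  - move=> r /ltW sr /ltW rs; rewrite !(s2_sym _ (x t)).
    have [s1 s1'] := neary _ sr rs.
    by apply: Hm; [rewrite d_refl|exact: Hy].
have W := weighted_ratio_le a0 b0 u0 v0 (ltW ep).
have N2 : 0 <= N / 2 * h by rewrite mulr_ge0 ?divr_ge0 ?ltW.
have {}W := ler_wpM2l N2 W.
have Be : e * B = e0 by rewrite divfK// gt_eqF.
apply: le_trans step1 _; rewrite -lerBrDr; apply: le_trans step2 _.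
rewrite -Be /B; lra.
Qed.

(** Gronwall over unit time with coefficient K (a + b). The denominator 2 (a + b) arises from the
    factor N / 2 and from expdiv (K (a + b)) 1 = expdiv K (a + b) / (a + b). *)
Lemma evi_contraction (a b : R) : 0 < a -> 0 < b ->
  s2 (x (tau1 + a)) (y (tau2 + b)) <= expR (- K * (a + b)) * s2 p q
    + N * expdiv K (a + b) * ((Num.sqrt a - Num.sqrt b) ^+ 2 / (2 * (a + b))).
Proof.
move=> a0 b0; have ab0 : 0 < a + b by exact: addr_gt0.
pose c := N / 2 * (Num.sqrt a - Num.sqrt b) ^+ 2.
have -> : N * expdiv K (a + b) * ((Num.sqrt a - Num.sqrt b) ^+ 2 / (2 * (a + b)))
    = c * expdiv (K * (a + b)) 1.
  rewrite /c /expdiv mulf_eq0 (gt_eqF ab0) orbF; case: ifPn => K0.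
    by field; rewrite gt_eqF.
  by rewrite mulr1 mulNr; field; rewrite K0 gt_eqF.
rewrite mulNr.
pose F r := s2 (x (tau1 + r * a)) (y (tau2 + r * b)).
rewrite -[a]mul1r -[b]mul1r -/(F 1) !mul1r.
have ta r : 0 < r -> tau1 < tau1 + r * a by move=> r0; rewrite ltrDl mulr_gt0.
have tb r : 0 < r -> tau2 < tau2 + r * b by move=> r0; rewrite ltrDl mulr_gt0.
apply: dini_gronwall_01.
- move=> r r0 _ e e0.
  have [m m0 Hm] := s2_continuous (x (tau1 + r * a)) (y (tau2 + r * b)) e0.
  have [nx nx0 Hx] := evi_flow_continuous flowx (ta r r0) m0.
  have [ny ny0 Hy] := evi_flow_continuous flowy (tb r r0) m0.
  exists (Num.min (nx / a) (ny / b)); first by rewrite lt_min !divr_gt0.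
  move=> s _ sr; rewrite ltrBlDr -ltrBlDl lt_min !ltr_pdivlMr// => /andP[sa sb].
  have sra : s * a < r * a by rewrite ltr_pM2r.
  have srb : s * b < r * b by rewrite ltr_pM2r.
  have dx : d (x (tau1 + s * a)) (x (tau1 + r * a)) < m by apply: Hx; lra.
  have dy : d (y (tau2 + s * b)) (y (tau2 + r * b)) < m by apply: Hy; lra.
  have := Hm _ _ dx dy; rewrite -/(F s) -/(F r) ltr_norml => /andP[]; lra.
- move=> r r0 _ e n e0 n0.
  have [h hn H] := evi_diagonal_dini a0 b0 (ta r r0) (tb r r0) e0 n0.
  exists h => //; move: H; rewrite -!addrA -!mulrDl /F !addrA.
  by rewrite -!mulNr.
- move=> e e0; have [m m0 Hm] := s2_continuous p q e0.
  have [nx nx0 Hx] := evi_start flowx m0.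
  have [ny ny0 Hy] := evi_start flowy m0.
  exists (Num.min (nx / a) (ny / b)); first by rewrite lt_min !divr_gt0.
  move=> r r0; rewrite lt_min !ltr_pdivlMr// => /andP[ra rb].
  have dx : d (x (tau1 + r * a)) p < m by apply: Hx; rewrite ?ltrD2l ?ta.
  have dy : d (y (tau2 + r * b)) q < m by apply: Hy; rewrite ?ltrD2l ?tb.
  have := Hm _ _ dx dy; rewrite -/(F r) ltr_norml => /andP[]; lra.
Qed.

End two_flows.
Lemma dist2_continuous p q : forall e : R, 0 < e -> exists2 n : R, 0 < n &
  forall p' q', d p' p < n -> d q' q < n -> `|d p' q' ^+ 2 - d p q ^+ 2| < e.
Proof.
move=> e e0; have D0 := d_ge0 p q.
have D1 : 0 < 2 * (d p q + 1) by lra.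
pose n := Num.min 1 (e / 4 / (2 * (d p q + 1))).
have n1 : n <= 1 by rewrite ge_min lexx.
have ne : n * (2 * (d p q + 1)) <= e / 4.
  by rewrite -ler_pdivlMr// ge_min lexx orbT.
have n0 : 0 < n by rewrite lt_min ltr01 !divr_gt0.
exists n => // p' q' pn qn.
have close : `|d p' q' - d p q| < 2 * n.
  rewrite (_ : _ - _ = (d p' q' - d p q') + (d p q' - d p q)); last by ring.
  apply: le_lt_trans (ler_normD _ _) _.
  have := dist_lipschitz p' p q'; have := dist_lipschitz q' q p.
  rewrite (d_sym p q') (d_sym p q); lra.
have D0' := d_ge0 p' q'.
rewrite subr_sqr normrM [X in _ * X]ger0_norm ?addr_ge0//.
have sumD : d p' q' + d p q <= 2 * (d p q + 1).
  by move: close; rewrite ltr_norml => /andP[]; lra.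
apply: (@le_lt_trans _ _ (2 * n * (2 * (d p q + 1)))).
  by apply: ler_pM => //; [rewrite addr_ge0|exact: ltW].
lra.
Qed.

(** With equal rates and starting points at distance 0, the contraction gives [s2] = 0. The
    conclusion is local in time because for K > 0 the function s_{K/N} has nonzero zeros; shortly
    after the start the distance is small enough for [sqr_s_quadratic]. *)
Lemma evi_unique tau1 tau2 p q x y : evi_flow tau1 p x -> evi_flow tau2 q y ->
  d p q = 0 -> exists2 n : R, 0 < n &
  forall h, 0 < h -> h < n -> d (x (tau1 + h)) (y (tau2 + h)) = 0.
Proof.
move=> fx fy pq.
have h20 : 0 < 2^-1 :> R by rewrite invr_gt0.
have h21 : 2^-1 <= 1 :> R by rewrite invf_le1 ?ler1n.
have [e e0 He] := sqr_s_quadratic (K / N) h20 h21.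
have e2 : 0 < e / 2 by lra.
have [nx nx0 Hx] := evi_start fx e2.
have [ny ny0 Hy] := evi_start fy e2.
exists (Num.min nx ny); first by rewrite lt_min nx0.
move=> h h0; rewrite lt_min => /andP[hx hy].
set D := d _ _; have D0 : 0 <= D by exact: d_ge0.
have De : D < e.
  apply: le_lt_trans (d_triangle p _ _) _.
  have := Hx (tau1 + h); rewrite ltrDl ltrD2l h0 hx => /(_ isT isT).
  have := Hy (tau2 + h); rewrite ltrDl ltrD2l h0 hy => /(_ isT isT).
  rewrite (d_sym (y _)); have := d_triangle q p (y (tau2 + h)); rewrite pq; lra.
have [+ _] := He D 0 (lexx 0) D0 De.
have -> : s_ (K / N) (2^-1 * 0) ^+ 2 = 0.
  by have := s2_eq0 (d_refl p); rewrite /s2 d_refl.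
have := evi_contraction fx fy h0 h0; rewrite subrr expr0n /= mul0r !mulr0 addr0.
rewrite (s2_eq0 pq) mulr0 /s2 -/D !subr0 => s0 D2.
have {}D2 : D ^+ 2 <= 0 by lra.
by apply/eqP; rewrite -sqrf_eq0 eq_le D2 sqr_ge0.
Qed.

Lemma evi_flow_restrict tau p x t : evi_flow tau p x -> tau < t ->
  evi_flow t (x t) x.
Proof.
move=> f tt; split.
- by move=> a b ta ab; apply: (evi_ac f) => //; exact: lt_trans tt ta.
- by move=> r tr; apply: (evi_dom f); exact: lt_trans tt tr.
- move=> e e0; have [n n0 Hn] := evi_flow_continuous f tt e0.
  by exists n => // r tr rn; apply: Hn => //; lra.
- move=> q Pq; case: (evi_ineq f Pq) => A [mA A0 badA]; exists A; split => //.
  apply: subset_trans badA => r /=; apply: contra_not => Hr tr.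
  by apply: Hr; exact: lt_trans tt tr.
Qed.

(* To first order in [h], and for close starting points, [s2] is a quarter of
   the squared distance up to a factor [1 + O(dl)]. *)
Lemma evi_contraction_local (dl : R) : 0 < dl -> dl <= 2^-1 ->
  exists2 e : R, 0 < e &
  forall al be p q x y, 0 < al -> 0 < be -> evi_flow 0 p x -> evi_flow 0 q y -> d p q < e ->
  forall eta : R, 0 < eta -> exists2 n : R, 0 < n &
  forall h, 0 < h -> h < n ->
    d (x (h * al)) (y (h * be)) ^+ 2 <= d p q ^+ 2
      + h * (- K * (al + be) * d p q ^+ 2
             + 2 * N * (Num.sqrt al - Num.sqrt be) ^+ 2
             + dl * (5 * `|K| * (al + be) * d p q ^+ 2
                     + 4 * N * (Num.sqrt al - Num.sqrt be) ^+ 2)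
             + eta).
Proof.
move=> dl0 dl2.
have dl1 : dl <= 1 by apply: le_trans dl2 _; rewrite invf_le1 ?ler1n.
have [e e0 He] := sqr_s_quadratic (K / N) dl0 dl1.
exists e => // al be p q x y al0 be0 fx fy Dx eta eta0.
set A := al + be; set w := (Num.sqrt al - Num.sqrt be) ^+ 2; set D := d p q in Dx *.
have A0 : 0 < A by exact: addr_gt0.
have w0 : 0 <= w by exact: sqr_ge0.
have D0 : 0 <= D by exact: d_ge0.
have z0 : s_ (K / N) (2^-1 * 0) ^+ 2 = 0.
  by have := s2_eq0 (d_refl p); rewrite /s2 d_refl.
pose F := s2 p q.
have [FD1 FD2] : (1 - dl) * D ^+ 2 <= 4 * F /\ 4 * F <= (1 + dl) * D ^+ 2.
  by have := He D 0 (lexx 0) D0 Dx; rewrite z0 expr0n /= !subr0.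
have F0 : 0 <= F by exact: s2_ge0.
pose Y := - K * A * F + N / 2 * w.
have eta8 : 0 < eta / 8 by lra.
have wA0 : 0 <= N * w / (2 * A).
  by apply: divr_ge0; apply: mulr_ge0 => //; exact: ltW.
(* The expansions of exp and [expdiv] get multiplied by F and by N w / (2 A); at this precision
   their total error is at most h eta / 8. *)
have B0 : 0 < (eta / 8) / (F + N * w / (2 * A) + 1) / A.
  by rewrite !divr_gt0// ltr_wpDl// addr_ge0.
set b := (_ / A) in B0.
have [m1 m10 Hm1] := expR_expansion_scale K B0.
have [m2 m20 Hm2] := expdiv_expansion K B0.
(* Each flow uses less than half of the room e - D, so the new distance stays in the range of
   [sqr_s_quadratic]. *)
have e2 : 0 < (e - D) / 2 by lra.
have [nx nx0 Hx] := evi_start fx e2.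
have [ny ny0 Hy] := evi_start fy e2.
exists (Num.min (Num.min (m1 / A) (m2 / A)) (Num.min (nx / al) (ny / be))).
  by rewrite !lt_min !divr_gt0.
move=> h h0; rewrite !lt_min !ltr_pdivlMr// => /andP[/andP[hm1 hm2] /andP[hnx hny]].
have ha0 : 0 < h * al by rewrite mulr_gt0.
have hb0 : 0 < h * be by rewrite mulr_gt0.
have hA0 : 0 < h * A by rewrite mulr_gt0.
set Dh := d _ _; have Dh0 : 0 <= Dh by exact: d_ge0.
have Dhe : Dh < e.
  apply: le_lt_trans (d_triangle p _ _) _.
  have := Hx (h * al) ha0; rewrite add0r => /(_ hnx).
  have := Hy (h * be) hb0; rewrite add0r => /(_ hny).
  rewrite (d_sym (y _)); have := d_triangle q p (y (h * be)); rewrite -/D; lra.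
have X : s2 (x (h * al)) (y (h * be)) - F <= h * (Y + eta / 8).
  have := evi_contraction fx fy ha0 hb0; rewrite !add0r -mulrDr -/A -/F.
  have -> : (Num.sqrt (h * al) - Num.sqrt (h * be)) ^+ 2 / (2 * (h * A)) = w / (2 * A).
    rewrite !sqrtrM ?ltW// -mulrBr exprMn sqr_sqrtr ?ltW// -/w.
    by field; rewrite !gt_eqF.
  have := Hm1 (h * A); rewrite hA0 hm1 => /(_ isT); rewrite ler_norml => /andP[_ k1].
  have := Hm2 (h * A); rewrite hA0 hm2 => /(_ isT); rewrite ler_norml => /andP[_ k2].
  have c1 := ler_wpM2r F0 k1.
  have c2 := ler_wpM2r wA0 k2.
  have bE : b * (F + N * w / (2 * A) + 1) * A = eta / 8.
    rewrite /b; set G := _ + 1; have G0 : 0 < G by rewrite ltr_wpDl// addr_ge0.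
    by field; rewrite !gt_eqF.
  have bh : 0 <= b * h * A by rewrite ltW// mulr_gt0// mulr_gt0.
  have -> : h * (Y + eta / 8) = - K * (h * A) * F + h * A * (N * w / (2 * A))
     + b * (h * A) * (F + N * w / (2 * A) + 1).
    by rewrite -bE /Y; field; rewrite gt_eqF.
  rewrite -[N * expdiv _ _ * _]mulrA [N * (_ * _)]mulrCA [N * (w / _)]mulrA => c3.
  move: c3 c1 c2 bh; lra.
set Z := Y + eta / 8 in X.
have key : Dh ^+ 2 - D ^+ 2 <= 4 * h * (Z + 2 * dl * `|Z|).
  apply: (sqr_gap_le dl0 dl2 Dh0 D0 h0 _ _ X) => [DDh|DhD].
    by have [] := He Dh D D0 DDh Dhe.
  by have [] := He D Dh Dh0 DhD Dx.
have bound := local_rate_le N_gt0 A0 w0 dl0 dl2 eta0 F0 FD1 FD2 (erefl Z).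
apply: (@le_trans _ _ (D ^+ 2 + 4 * h * (Z + 2 * dl * `|Z|))).
  by rewrite -lerBlDl.
rewrite lerD2l -[4 * h * _]mulrA [4 * (h * _)]mulrCA.
exact: (ler_wpM2l (ltW h0) bound).
Qed.

(** * From [s2] to the squared distance, along geodesics *)

Section geodesic.
Hypothesis geodesic : forall p q, P p -> P q -> exists g : R -> T,
  [/\ d (g 0) p = 0, d (g 1) q = 0 &
    forall s t, 0 <= s <= 1 -> 0 <= t <= 1 ->
      d (g s) (g t) = `|t - s| * d (g 0) (g 1)].
Hypothesis flow_exists : forall p, exists x, evi_flow 0 p x.
Variables (p q : T) (x y : R -> T).
Hypothesis flowx : evi_flow 0 p x.
Hypothesis flowy : evi_flow 0 q y.

Lemma dist_chain (z : nat -> T) (n : nat) :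
  d (z 0) (z n) <= \sum_(i < n) d (z i) (z i.+1).
Proof.
elim: n => [|n IH]; first by rewrite big_ord0 d_refl.
by rewrite big_ord_recr /=; apply: le_trans (d_triangle (z n) _ _) _; rewrite lerD2r.
Qed.

Lemma evi_dist_dini (a b t s : R) : 0 < a -> 0 < b -> 0 < t -> 0 < s ->
  forall e n : R, 0 < e -> 0 < n -> exists2 h : R, 0 < h < n &
    d (x (t + h * a)) (y (s + h * b)) ^+ 2 <= d (x t) (y s) ^+ 2 +
      h * (- (K * (2 / 3 * (a + Num.sqrt a * Num.sqrt b + b))) * d (x t) (y s) ^+ 2
           + 2 * N * (Num.sqrt a - Num.sqrt b) ^+ 2 + e).
Proof.
move=> a0 b0 t0 s0 e k e0 k0.
set tau := 2 / 3 * _; set w := (Num.sqrt a - Num.sqrt b) ^+ 2.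
set D := d (x t) (y s).
have [g [g0 g1 gd]] := geodesic (evi_dom flowx t0) (evi_dom flowy s0).
have gD : d (g 0) (g 1) = D.
  apply/eqP; rewrite eq_le; apply/andP; split.
    have := d_triangle (x t) (g 0) (g 1); have := d_triangle (y s) (x t) (g 1).
    by rewrite g0 (d_sym (y s)) g1 /D; lra.
  have := d_triangle (g 0) (x t) (y s); have := d_triangle (g 1) (g 0) (y s).
  by rewrite g1 (d_sym (x t) (g 0)) g0 /D; lra.
have D0 : 0 <= D by exact: d_ge0.
have D20 : 0 <= D ^+ 2 by exact: sqr_ge0.
have w0 : 0 <= w by exact: sqr_ge0.
have sa0 : 0 < Num.sqrt a by rewrite sqrtr_gt0.
have sb0 : 0 < Num.sqrt b by rewrite sqrtr_gt0.
have tau0 : 0 < tau by rewrite /tau mulr_gt0 ?divr_gt0// !addr_gt0// mulr_gt0.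
have KD : 0 <= `|K| * D ^+ 2 by rewrite mulr_ge0.
have Nw : 0 <= N * w by rewrite mulr_ge0// ltW.
(* The tolerance [e] is spent in quarters: one on the distortion [dl * E] between [s2] and the
   distance, one on the trapezoidal error, one on the tolerances of the pieces. In [E], [w] stands
   for the trapezoidal error w / (3 n^2), which it dominates. *)
pose E := 5 * (`|K| * D ^+ 2 * (tau + w)) + 4 * (N * w).
have E0 : 0 <= E.
  have tw : 0 <= tau + w by rewrite addr_ge0// ltW.
  by rewrite /E addr_ge0// mulr_ge0// mulr_ge0.
pose dl := Num.min 2^-1 (e / 4 / (E + 1)).
have h20 : 0 < 2^-1 :> R by rewrite invr_gt0.
have dl0 : 0 < dl by rewrite lt_min h20 !divr_gt0// ltr_wpDl.
have dl2 : dl <= 2^-1 by rewrite ge_min lexx.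
have dlE : dl * E <= e / 4.
  apply: (@le_trans _ _ (dl * (E + 1))); first by rewrite ler_pM2l// lerDl.
  by rewrite -ler_pdivlMr ?ltr_wpDl// ge_min lexx orbT.
have [r r0 Hr] := evi_contraction_local dl0 dl2.
have KDw : 0 <= `|K| * D ^+ 2 * w / (e / 4).
  by apply: divr_ge0; [exact: mulr_ge0|rewrite ltW// divr_gt0].
have Dr0 : 0 <= D / r by rewrite divr_ge0// ltW.
(* The first summand makes the pieces shorter than the range [r] of the local estimate; the second
   brings the trapezoidal error, multiplied by |K| D^2, below e/4. *)
have [n nbig] : exists n : nat, D / r + `|K| * D ^+ 2 * w / (e / 4) < n%:R.
  eexists; apply: archi_boundP.
  exact: addr_ge0.
have n0 : 0 < n%:R :> R by apply: le_lt_trans nbig; exact: addr_ge0.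
have n1 : 1 <= n%:R :> R by rewrite ler1n -(ltr0n R).
have Dn : D / n%:R < r.
  by rewrite ltr_pdivrMr// mulrC -ltr_pdivrMr//; apply: le_lt_trans nbig; rewrite lerDl.
have KDwn : `|K| * D ^+ 2 * (w / (3 * n%:R ^+ 2)) <= e / 4.
  apply: (@le_trans _ _ (`|K| * D ^+ 2 * (w / n%:R))).
    rewrite ler_wpM2l// ler_wpM2l// lef_pV2 ?posrE ?mulr_gt0//.
    by rewrite expr2 mulrA ler_pMl//; lra.
  rewrite mulrA ler_pdivrMr// [leRHS]mulrC -ler_pdivrMr ?divr_gt0//.
  by apply: ltW; apply: le_lt_trans nbig; rewrite lerDr.
have wn : w / (3 * n%:R ^+ 2) <= w.
  rewrite ler_pdivrMr ?mulr_gt0//; rewrite ler_peMr//.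
  have : 1 <= n%:R ^+ 2 :> R by rewrite exprn_ege1.
  lra.
have wn0 : 0 <= w / (3 * n%:R ^+ 2) by rewrite divr_ge0// mulr_ge0.
pose l := (Num.sqrt b - Num.sqrt a) / n%:R.
pose om i := Num.sqrt a + i%:R * l.
have om0 i : (i <= n)%N -> 0 < om i.
  move=> ni; have inn : i%:R / n%:R <= 1 :> R by rewrite ler_pdivrMr// mul1r ler_nat.
  have i0 : 0 <= i%:R / n%:R :> R by rewrite divr_ge0.
  rewrite /om /l (_ : _ + _ = (1 - i%:R / n%:R) * Num.sqrt a + i%:R / n%:R * Num.sqrt b); last first.
    by field; rewrite gt_eqF.
  have [->|i1] := eqVneq (i%:R / n%:R : R) 1; first by rewrite subrr mul0r add0r mul1r.
  by rewrite ltr_pwDl// ?mulr_gt0 ?mulr_ge0 ?(ltW sb0)// subr_gt0 lt_neqAle i1.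
have sqrt_om i : (i <= n)%N -> Num.sqrt (om i ^+ 2) = om i.
  by move=> ni; rewrite sqrtr_sqr gtr0_norm// om0.
have om00 : om 0%N ^+ 2 = a by rewrite /om mul0r addr0 sqr_sqrtr// ltW.
have omn : om n ^+ 2 = b.
  rewrite (_ : om n = Num.sqrt b) ?sqr_sqrtr// ?ltW//.
  by rewrite /om /l; field; rewrite gt_eqF.
have l2 : l ^+ 2 = w / n%:R ^+ 2 by rewrite /l /w; field; rewrite gt_eqF.
have [z Hz] := choice (fun i : nat => flow_exists (g (i%:R / n%:R))).
have dg i : (i < n)%N -> d (g (i%:R / n%:R)) (g (i.+1%:R / n%:R)) = D / n%:R.
  move=> ni; rewrite gd ?divr_ge0 ?ler_pdivrMr ?mul1r ?ler_nat ?(ltnW ni)//.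
  by rewrite gD -mulrBl -natrB// subSnn mul1r ger0_norm ?invr_ge0// mulrC.
pose A i := om i ^+ 2 + om i.+1 ^+ 2.
pose k1 := (- K + 5 * dl * `|K|) * (D / n%:R) ^+ 2.
(* The tolerance e/4/n^2 per piece becomes e/4 after the sum over n pieces and the factor n of
   [sqr_sum_le]. *)
pose k2 := (2 + 4 * dl) * N * (w / n%:R ^+ 2) + e / 4 / n%:R ^+ 2.
have piece i : (i < n)%N -> exists2 m : R, 0 < m & forall h, 0 < h -> h < m ->
    d (z i (h * om i ^+ 2)) (z i.+1 (h * om i.+1 ^+ 2)) ^+ 2 <=
    (D / n%:R) ^+ 2 + h * (k1 * A i + k2).
  move=> ni.
  have eta0 : 0 < e / 4 / n%:R ^+ 2 by rewrite !divr_gt0// exprn_gt0.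
  have oi : 0 < om i ^+ 2 by rewrite exprn_gt0// om0// ltnW.
  have oi1 : 0 < om i.+1 ^+ 2 by rewrite exprn_gt0// om0.
  have dgr : d (g (i%:R / n%:R)) (g (i.+1%:R / n%:R)) < r by rewrite dg.
  have [m m0 Hm] := Hr _ _ _ _ _ _ oi oi1 (Hz i) (Hz i.+1) dgr _ eta0.
  exists m => // h h0 hm; apply: le_trans (Hm h h0 hm) _.
  rewrite dg// !sqrt_om ?(ltnW ni)// -/(A i).
  have -> : (om i - om i.+1) ^+ 2 = w / n%:R ^+ 2.
    by rewrite -l2 /om -natr1; ring.
  by rewrite lerD2l ler_pM2l// le_eqVlt; apply/orP; left; apply/eqP; rewrite /k1 /k2; ring.
have [m m0 Hm] := eventually_forall_lt piece.
(* The ends of the geodesic are only at distance 0 from [x t] and [y s], and the flows [z 0] and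
   [z n] were chosen independently of [x] and [y]. *)
have gx0 : d (x t) (g (0%:R / n%:R)) = 0 by rewrite mul0r d_sym.
have gyn : d (y s) (g (n%:R / n%:R)) = 0 by rewrite divff ?gt_eqF// d_sym.
have [mx mx0 Hmx] := evi_unique (evi_flow_restrict flowx t0) (Hz 0%N) gx0.
have [my my0 Hmy] := evi_unique (evi_flow_restrict flowy s0) (Hz n) gyn.
pose h := Num.min (Num.min k m) (Num.min (mx / a) (my / b)) / 2.
have [h0 hm'] : 0 < h /\ h < Num.min (Num.min k m) (Num.min (mx / a) (my / b)).
  have : 0 < Num.min (Num.min k m) (Num.min (mx / a) (my / b)).
    by rewrite !lt_min k0 m0 !divr_gt0.
  by rewrite /h; lra.
move: hm'; rewrite !lt_min !ltr_pdivlMr// => /andP[/andP[hk hm] /andP[hx hy]].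
exists h; first by rewrite h0.
pose zz i := z i (h * om i ^+ 2).
have ha0 : 0 < h * a by rewrite mulr_gt0.
have hb0 : 0 < h * b by rewrite mulr_gt0.
have dzz : d (x (t + h * a)) (y (s + h * b)) <= d (zz 0%N) (zz n).
  have X0 := Hmx (h * a) ha0 hx; have Y0 := Hmy (h * b) hb0 hy.
  rewrite add0r in X0; rewrite add0r d_sym in Y0.
  rewrite /zz om00 omn; apply: le_trans (d_triangle (z 0%N (h * a)) _ _) _.
  rewrite X0 add0r; apply: le_trans (d_triangle (z n (h * b)) _ _) _.
  by rewrite Y0 addr0.
pose c i := d (zz i) (zz i.+1).
have le1 : d (x (t + h * a)) (y (s + h * b)) ^+ 2 <= n%:R * \sum_(i < n) c i ^+ 2.
  apply: le_trans (sqr_sum_le c n); rewrite lerXn2r ?nnegrE ?d_ge0//.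
    by apply: sumr_ge0 => i _; exact: d_ge0.
  exact: le_trans dzz (dist_chain zz n).
have le2 : \sum_(i < n) c i ^+ 2 <= \sum_(i < n) ((D / n%:R) ^+ 2 + h * (k1 * A i + k2)).
  by apply: ler_sum => i _; exact: Hm.
have sumA : \sum_(i < n) A i = n%:R * (tau + w / (3 * n%:R ^+ 2)).
  rewrite /A trapezoid_sum_sqr l2.
  have -> : Num.sqrt a + n%:R * l = Num.sqrt b.
    by rewrite /l; field; rewrite gt_eqF.
  by rewrite !sqr_sqrtr ?(ltW a0) ?(ltW b0)// /tau; field; rewrite gt_eqF.
have sumE : n%:R * \sum_(i < n) ((D / n%:R) ^+ 2 + h * (k1 * A i + k2)) =
    D ^+ 2 + h * ((- K + 5 * dl * `|K|) * D ^+ 2 * (tau + w / (3 * n%:R ^+ 2))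
      + (2 + 4 * dl) * N * w + e / 4).
  by rewrite sum_affine sumA /k1 /k2; field; rewrite gt_eqF.
apply: le_trans le1 _; apply: le_trans (ler_wpM2l (ltW n0) le2) _.
rewrite sumE lerD2l ler_pM2l//.
move: (w / (3 * _)) wn wn0 KDwn => v vw v0 KDv.
have K1 : - K * (D ^+ 2 * v) <= `|K| * D ^+ 2 * v.
  by rewrite -mulrA ler_wpM2r ?mulr_ge0// -normrN ler_norm.
have K2 : dl * (`|K| * D ^+ 2 * v) <= dl * (`|K| * D ^+ 2 * w).
  by rewrite ler_pM2l// ler_wpM2l.
move: dlE; rewrite /E.
lra.
Qed.

Lemma evi_contraction_dist (a b : R) : 0 < a -> 0 < b ->
  d (x a) (y b) ^+ 2 <=
    expR (- (K * (2 / 3 * (a + Num.sqrt a * Num.sqrt b + b)))) * d p q ^+ 2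
    + 2 * N * (Num.sqrt a - Num.sqrt b) ^+ 2
      * expdiv (K * (2 / 3 * (a + Num.sqrt a * Num.sqrt b + b))) 1.
Proof.
move=> a0 b0.
pose F r := d (x (r * a)) (y (r * b)) ^+ 2.
rewrite -[in x a](mul1r a) -[in y b](mul1r b) -/(F 1).
have ra0 r : 0 < r -> 0 < r * a by move=> r0; rewrite mulr_gt0.
have rb0 r : 0 < r -> 0 < r * b by move=> r0; rewrite mulr_gt0.
apply: dini_gronwall_01.
- move=> r r0 _ e e0.
  have [m m0 Hm] := dist2_continuous (x (r * a)) (y (r * b)) e0.
  have [nx nx0 Hx] := evi_flow_continuous flowx (ra0 r r0) m0.
  have [ny ny0 Hy] := evi_flow_continuous flowy (rb0 r r0) m0.
  exists (Num.min (nx / a) (ny / b)); first by rewrite lt_min !divr_gt0.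
  move=> s _ sr; rewrite ltrBlDr -ltrBlDl lt_min !ltr_pdivlMr// => /andP[sa sb].
  have sra : s * a < r * a by rewrite ltr_pM2r.
  have srb : s * b < r * b by rewrite ltr_pM2r.
  have dx : d (x (s * a)) (x (r * a)) < m by apply: Hx; lra.
  have dy : d (y (s * b)) (y (r * b)) < m by apply: Hy; lra.
  have := Hm _ _ dx dy; rewrite -/(F s) -/(F r) ltr_norml => /andP[]; lra.
- move=> r r0 _ e n e0 n0.
  have [h hn H] := evi_dist_dini a0 b0 (ra0 r r0) (rb0 r r0) e0 n0.
  by exists h => //; move: H; rewrite -!mulrDl.
- move=> e e0; have [m m0 Hm] := dist2_continuous p q e0.
  have [nx nx0 Hx] := evi_start flowx m0.
  have [ny ny0 Hy] := evi_start flowy m0.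
  exists (Num.min (nx / a) (ny / b)); first by rewrite lt_min !divr_gt0.
  move=> r r0; rewrite lt_min !ltr_pdivlMr// => /andP[ra rb].
  have dx : d (x (r * a)) p < m by apply: Hx; rewrite ?add0r ?ra0.
  have dy : d (y (r * b)) q < m by apply: Hy; rewrite ?add0r ?rb0.
  have := Hm _ _ dx dy; rewrite -/(F r) ltr_norml => /andP[]; lra.
Qed.

End geodesic.
End evi_flows.

(** * The Wasserstein distance is a pseudometric *)

Section probability_constructions.
Context {R : realType}.
Local Open Scope ereal_scope.

Lemma probability_of_measure d (T : measurableType d)
    (M : {measure set T -> \bar R}) : M setT = 1 ->
  exists P : probability T R, forall A, P A = M A.
Proof.
move=> M1; exists (mnormalize M (@dirac _ T point R)) => A.
by rewrite /= /mnormalize M1 onee_eq0 /= invr1 mule1.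
Qed.

Lemma integral_probability_cst d (T : measurableType d) (P : probability T R)
  (c : R) : \int[P]_x c%:E = c%:E.
Proof. by rewrite integral_cst//= probability_setT mule1. Qed.

Lemma probability_pushforward d1 d2 (T1 : measurableType d1)
    (T2 : measurableType d2) (P : probability T1 R) (f : T1 -> T2) :
  measurable_fun setT f ->
  exists2 Q : probability T2 R, (forall A, Q A = P (f @^-1` A)) &
    forall g : T2 -> \bar R, measurable_fun setT g -> (forall x, 0 <= g x) ->
      \int[Q]_x g x = \int[P]_x g (f x).
Proof.
move=> mf.
pose X : {mfun T1 >-> T2} := HB.pack f (isMeasurableFun.Build _ _ _ _ f mf).
exists (distribution P X) => // g mg g0.
by rewrite ge0_integral_pushforward// preimage_setT.
Qed.

Lemma integral_marginal d1 d2 (T1 : measurableType d1)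
    (T2 : measurableType d2) (P : probability T1 R) (Q : probability T2 R)
    (f : T1 -> T2) : measurable_fun setT f ->
  (forall A, measurable A -> P (f @^-1` A) = Q A) ->
  forall g : T2 -> \bar R, measurable_fun setT g -> (forall x, 0 <= g x) ->
    \int[P]_x g (f x) = \int[Q]_x g x.
Proof.
move=> mf PQ g mg g0; have [Q' Q'E <- //] := probability_pushforward P mf.
by apply: eq_measure_integral => A mA _; exact: etrans (Q'E A) (PQ A mA).
Qed.

(* The two couplings are glued along the cells [A i]: on
   [(T1 * A i) * (A i * T3)] take the product [p \x q] divided by the common
   mass of [A i].  No disintegration is needed. *)
Lemma gluing_on_partition d1 d2 d3 (T1 : measurableType d1)
    (T2 : measurableType d2) (T3 : measurableType d3)
    (p : probability (T1 * T2)%type R) (q : probability (T2 * T3)%type R)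
    (A : nat -> set T2) :
  (forall i, measurable (A i)) -> trivIset setT A -> \bigcup_i A i = setT ->
  (forall i, p (setT `*` A i) = q (A i `*` setT)) ->
  exists P : probability ((T1 * T2) * (T2 * T3))%type R,
  [/\ forall E, measurable E -> P (E `*` setT) = p E,
      forall E, measurable E -> P (setT `*` E) = q E &
      P.-negligible [set z | forall i, ~ (A i z.1.2 /\ A i z.2.1)]].
Proof.
move=> mA tA UA pq.
pose m i := p (setT `*` A i).
have mTA i : measurable (setT `*` A i : set (T1 * T2)) by exact: measurableX.
have mAT i : measurable (A i `*` setT : set (T2 * T3)) by exact: measurableX.
have mfin i : m i \is a fin_num by apply: fin_num_measure.
pose B i : set ((T1 * T2) * (T2 * T3)) := (setT `*` A i) `*` (A i `*` setT).
have mB i : measurable (B i) by exact: measurableX.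
have c0 i : (0 <= (fine (m i))^-1)%R by rewrite invr_ge0 fine_ge0.
pose M := mseries (fun i => mscale (NngNum (c0 i)) (mrestr (p \x q) (mB i))) 0.
have ME E F : measurable E -> measurable F ->
    M (E `*` F) = \sum_(0 <= i <oo) ((fine (m i))^-1%:E *
      (p (E `&` (setT `*` A i)) * q (F `&` (A i `*` setT)))).
  move=> mE mF; rewrite /M /= /mseries; apply: eq_eseriesr => i _.
  transitivity ((fine (m i))^-1%:E * (p \x q) ((E `*` F) `&` B i)) => //.
  rewrite /B -setXI; congr (_ * _).
  by rewrite product_measure1E//; exact: measurableI.
(* On a cell of mass 0 the inverse is 0 by convention, and x, squeezed between 0 and [m i], vanishes
   as well. *)
have cm i x : 0 <= x -> x <= m i -> (fine (m i))^-1%:E * (x * m i) = x.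
  move=> x0 xm; have [m0|m0] := eqVneq (m i) 0.
    have -> : x = 0 by apply/eqP; rewrite eq_le x0 -m0 xm.
    by rewrite mul0e mule0.
  have xfin : x \is a fin_num by rewrite ge0_fin_numE// (le_lt_trans xm)// ltey_eq mfin.
  rewrite -(fineK xfin) -(fineK (mfin i)) /= -!EFinM; congr (_%:E).
  by field; rewrite fine_eq0.
have cm' i x : 0 <= x -> x <= m i -> (fine (m i))^-1%:E * (m i * x) = x.
  by move=> *; rewrite [m i * x]muleC cm.
have ptot E : measurable E -> \sum_(0 <= i <oo) p (E `&` (setT `*` A i)) = p E.
  move=> mE; have tF : trivIset setT (fun i => E `&` (setT `*` A i)).
    apply: trivIset_setIl; move/trivIsetP : tA => tA; apply/trivIsetP => i j _ _ ij.
    by rewrite -setXI (tA i j)// setX0.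
  have {2}-> : E = \bigcup_i (E `&` (setT `*` A i)).
    by rewrite -setI_bigcupr -setX_bigcupr UA setXTT setIT.
  rewrite measure_bigcup//; last by move=> i _; exact: measurableI.
  by apply: eq_eseriesl => i; rewrite in_setT.
have qtot E : measurable E -> \sum_(0 <= i <oo) q (E `&` (A i `*` setT)) = q E.
  move=> mE; have tF : trivIset setT (fun i => E `&` (A i `*` setT)).
    apply: trivIset_setIl; move/trivIsetP : tA => tA; apply/trivIsetP => i j _ _ ij.
    by rewrite -setXI (tA i j)// set0X.
  have {2}-> : E = \bigcup_i (E `&` (A i `*` setT)).
    by rewrite -setI_bigcupr -setX_bigcupl UA setXTT setIT.
  rewrite measure_bigcup//; last by move=> i _; exact: measurableI.
  by apply: eq_eseriesl => i; rewrite in_setT.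
have M1 E : measurable E -> M (E `*` setT) = p E.
  move=> mE; rewrite ME// -ptot//; apply: eq_eseriesr => i _.
  rewrite setTI -pq -/(m i) cm//; apply: le_measure; rewrite ?inE//.
  exact: measurableI.
have M2 E : measurable E -> M (setT `*` E) = q E.
  move=> mE; rewrite ME// -qtot//; apply: eq_eseriesr => i _.
  rewrite setTI -/(m i) cm'//; rewrite /m pq; apply: le_measure; rewrite ?inE//.
  exact: measurableI.
have MT : M setT = 1 by rewrite -setXTT M1// probability_setT.
have [P HP] := probability_of_measure MT.
exists P; split.
- by move=> E mE; exact: etrans (HP _) (M1 _ mE).
- by move=> E mE; exact: etrans (HP _) (M2 _ mE).
- have mN : measurable (~` \bigcup_i B i) by apply: measurableC; exact: bigcup_measurable.
  exists (~` \bigcup_i B i); split => //.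
    apply/eqP; rewrite HP /M /= /mseries eseries0// => i _ _.
    transitivity ((fine (m i))^-1%:E * (p \x q) ((~` \bigcup_i B i) `&` B i)) => //.
    rewrite (_ : _ `&` _ = set0) ?measure0 ?mule0//.
    by apply/seteqP; split => // z [nB Bz]; apply: nB; exists i.
  by move=> z /= nz [i _ [[_ Az1] [Az2 _]]]; exact: (nz i).
Qed.

End probability_constructions.

(** Cauchy-Schwarz with weights al, be, e. If u^2 and v^2 integrate to at most al^2 and be^2, the
    right-hand side integrates to at most (al + be + e)^2; this takes the place of Minkowski's
    inequality. *)
Lemma sqr_sum3_le {R : realFieldType} (u v al be e : R) :
  0 < al -> 0 < be -> 0 < e ->
  (u + v + e) ^+ 2 <=
    (al + be + e) / al * u ^+ 2 + ((al + be + e) / be * v ^+ 2 + (al + be + e) * e).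
Proof.
move=> al0 be0 e0; rewrite -subr_ge0.
have -> : (al + be + e) / al * u ^+ 2
    + ((al + be + e) / be * v ^+ 2 + (al + be + e) * e) - (u + v + e) ^+ 2 =
    al * be * (u / al - v / be) ^+ 2 + al * e * (u / al - 1) ^+ 2
    + be * e * (v / be - 1) ^+ 2.
  by field; rewrite !gt_eqF.
by rewrite !addr_ge0// mulr_ge0 ?sqr_ge0// mulr_ge0// ltW.
Qed.

(** * Couplings and the axioms of a pseudometric *)

Section wasserstein_pseudometric.
Context {R : realType} {X : completeMetricType R}.
Hypothesis sepX : @separable R X.
Implicit Types mu nu : P2 X.

Lemma open_mdist_lt (x : X) (r : R) : open [set y : X | mdist x y < r].
Proof.
rewrite openE => y /= xyr; rewrite /interior; apply/nbhs_ballP.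
exists (r - mdist x y); first by rewrite /= subr_gt0.
move=> z; rewrite ballEmdist /= => yz.
by apply: le_lt_trans (metric_triangle x y z) _; rewrite addrC -ltrBrDr.
Qed.

Lemma separable_seq : exists c : nat -> X,
  forall (x : X) (e : R), 0 < e -> exists i, mdist (c i) x < e.
Proof.
have [D cD dD] := sepX.
have [D0|[c]] := pfcard_geP cD.
  have [] := dD setT; [by exists point|exact: openT|].
  by move=> y [_]; rewrite D0.
exists c => x e e0.
have [] := dD [set y | mdist x y < e]; [by exists x; rewrite /= mdistxx|exact: open_mdist_lt|].
move=> y [/= xy Dy]; have [i _ cy] := 'surj_c Dy.
by exists i; rewrite cy metric_sym.
Qed.

Lemma measurable_mdist_point (x : X) :
  measurable_fun setT (fun y : borel X => mdist x (y : X)).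
Proof.
move=> _; apply: (measurability _ (RGenInftyO.measurableE R)) => //.
move=> _ [_ [r ->] <-]; rewrite setTI; apply: sub_sigma_algebra.
rewrite (_ : _ @^-1` _ = [set y : X | mdist x y < r]); first exact: open_mdist_lt.
by apply/seteqP; split => y; rewrite /= in_itv.
Qed.

(** The product carries the product of the Borel algebras, so openness of sublevel sets is not
    enough. Separability writes them as countable unions of the sets d(c i, x) + d(c i, y) < r. *)
Lemma measurable_mdist :
  measurable_fun setT (fun z : borel X * borel X => mdist (z.1 : X) (z.2 : X)).
Proof.
have [c Hc] := separable_seq.
move=> _; apply: (measurability _ (RGenInftyO.measurableE R)) => //.
move=> _ [_ [r ->] <-]; rewrite setTI.
pose h i (z : borel X * borel X) := mdist (c i) (z.1 : X) + mdist (c i) (z.2 : X).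
rewrite (_ : _ @^-1` _ = \bigcup_i (h i @^-1` `]-oo, r[)).
  apply: bigcup_measurable => i _; rewrite -[X in measurable X]setTI.
  have mh : measurable_fun setT (h i).
    apply: measurable_funD.
      exact: (measurableT_comp (measurable_mdist_point (c i)) measurable_fst).
    exact: (measurableT_comp (measurable_mdist_point (c i)) measurable_snd).
  exact: mh.
apply/seteqP; split => z; rewrite /= in_itv /=.
  move=> zr; have e0 : 0 < (r - mdist (z.1 : X) z.2) / 2 by rewrite divr_gt0// subr_gt0.
  have [i ci] := Hc z.1 _ e0; exists i => //=; rewrite in_itv /= /h.
  have := metric_triangle (c i) z.1 z.2; lra.
move=> [i _] /=; rewrite in_itv /= /h; apply: le_lt_trans.
by rewrite (metric_sym (c i)) metric_triangle.
Qed.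

Lemma measurable_sqr_mdist : measurable_fun setT
  (fun z : borel X * borel X => (mdist (z.1 : X) (z.2 : X) ^+ 2)%:E).
Proof. by apply/measurable_EFinP; apply: measurable_funX; exact: measurable_mdist. Qed.

Definition cost (q : probability (borel X * borel X)%type R) : \bar R :=
  (\int[q]_z (mdist (z.1 : X) (z.2 : X) ^+ 2)%:E)%E.

Lemma cost_ge0 q : (0 <= cost q)%E.
Proof. by apply: integral_ge0 => z _; rewrite lee_fin sqr_ge0. Qed.

Lemma W2_ge0 mu nu : 0 <= W2 mu nu.
Proof. exact: sqrtr_ge0. Qed.

Lemma W2_le mu nu q (a : R) : coupling mu nu q -> 0 <= a ->
  (cost q <= (a ^+ 2)%:E)%E -> W2 mu nu <= a.
Proof.
move=> cq a0 qa; rewrite /W2 -[leRHS](ger0_norm a0) -sqrtr_sqr ler_wsqrtr//.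
set I := ereal_inf _.
have I0 : (0 <= I)%E by apply: le_ereal_inf_tmp => _ [q' _ <-]; exact: cost_ge0.
have Ia : (I <= (a ^+ 2)%:E)%E.
  by apply: le_trans qa; apply: ereal_inf_lbound; exists q.
have Ifin : I \is a fin_num by rewrite ge0_fin_numE// (le_lt_trans Ia)// ltry.
by rewrite -lee_fin fineK.
Qed.

Lemma coupling_fst mu nu q : coupling mu nu q ->
  forall g : borel X -> \bar R, measurable_fun setT g -> (forall x, 0 <= g x)%E ->
    (\int[q]_z g z.1 = \int[mu]_x g x)%E.
Proof.
move=> cq g mg g0; apply: (integral_marginal measurable_fst) => // A mA.
rewrite (_ : _ @^-1` _ = A `*` setT); first by have [] := cq A mA.
by apply/seteqP; split => // z [].
Qed.

Lemma coupling_snd mu nu q : coupling mu nu q ->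
  forall g : borel X -> \bar R, measurable_fun setT g -> (forall x, 0 <= g x)%E ->
    (\int[q]_z g z.2 = \int[nu]_x g x)%E.
Proof.
move=> cq g mg g0; apply: (integral_marginal measurable_snd) => // A mA.
rewrite (_ : _ @^-1` _ = setT `*` A); first by have [] := cq A mA.
by apply/seteqP; split => // z [].
Qed.

(** Finite cost of one coupling makes the infimum in [W2] finite, so that [fine] returns its true
    value and not the default 0. *)
Lemma product_coupling mu nu : exists2 q, coupling mu nu q & (cost q < +oo)%E.
Proof.
pose q : probability (borel X * borel X)%type R := (P2_prob mu \x P2_prob nu)%E.
have cq : coupling mu nu q.
  move=> A mA; split.
    transitivity (P2_prob mu A * P2_prob nu setT)%E; first exact: product_measure1E.
    by rewrite probability_setT mule1.
  transitivity (P2_prob mu setT * P2_prob nu A)%E; first exact: product_measure1E.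
  by rewrite probability_setT mul1e.
clearbody q; exists q => //.
have [a ma] := P2_moment mu; have [b nb] := P2_moment nu.
have ms (c : X) : measurable_fun setT (fun x : borel X => (mdist c (x : X) ^+ 2)%:E).
  by apply/measurable_EFinP; apply: measurable_funX; exact: measurable_mdist_point.
(* The two moments are taken around possibly different points a and b, so the distance is estimated
   through both; 3 comes from (u + v + w)^2 <= 3 (u^2 + v^2 + w^2). *)
have bound : (cost q <= \int[q]_z (3%:E * (mdist a (z.1 : X) ^+ 2)%:E +
    (3%:E * (mdist b (z.2 : X) ^+ 2)%:E + (3 * mdist a b ^+ 2)%:E)))%E.
  apply: ge0_le_integral => //.
  - by move=> z _; rewrite lee_fin sqr_ge0.
  - exact: measurable_sqr_mdist.
  - apply: emeasurable_funD.
      apply: measurable_funeM; exact: (measurableT_comp (ms a) measurable_fst).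
    apply: emeasurable_funD; last exact: measurable_cst.
    apply: measurable_funeM; exact: (measurableT_comp (ms b) measurable_snd).
  move=> z _; rewrite -!EFinM -!EFinD lee_fin.
  have t1 := metric_triangle (z.1 : X) a z.2; have t2 := metric_triangle a b (z.2 : X).
  rewrite (metric_sym _ a) in t1.
  have p0 := mdist_ge0 (z.1 : X) z.2; have p1 := mdist_ge0 a (z.1 : X).
  have p2 := mdist_ge0 a b; have p3 := mdist_ge0 b (z.2 : X).
  set D := mdist (z.1 : X) z.2 in t1 p0 *; set u := mdist a (z.1 : X) in t1 p1 *.
  set v := mdist b (z.2 : X) in t2 p3 *; set w := mdist a b in t2 p2 *.
  have Duvw : D <= u + (v + w) by lra.
  apply: (@le_trans _ _ ((u + (v + w)) ^+ 2)).
    by rewrite lerXn2r ?nnegrE ?addr_ge0.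
  have := sqr_ge0 (u - v); have := sqr_ge0 (u - w); have := sqr_ge0 (v - w).
  clear; nra.
apply: le_lt_trans bound _.
have m1 : measurable_fun setT (fun z : borel X * borel X => (mdist a (z.1 : X) ^+ 2)%:E).
  exact: (measurableT_comp (ms a) measurable_fst).
have m2 : measurable_fun setT (fun z : borel X * borel X => (mdist b (z.2 : X) ^+ 2)%:E).
  exact: (measurableT_comp (ms b) measurable_snd).
rewrite ge0_integralD//; last 4 first.
- by move=> z _; rewrite mule_ge0 ?lee_fin ?sqr_ge0.
- exact: measurable_funeM.
- by move=> z _; rewrite adde_ge0 ?mule_ge0 ?lee_fin ?sqr_ge0// mulr_ge0 ?sqr_ge0.
- by apply: emeasurable_funD; [exact: measurable_funeM|exact: measurable_cst].
rewrite ge0_integralD//; last 3 first.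
- by move=> z _; rewrite mule_ge0 ?lee_fin ?sqr_ge0.
- exact: measurable_funeM.
- by move=> z _; rewrite lee_fin mulr_ge0 ?sqr_ge0.
rewrite !ge0_integralZl//; last 2 first.
- by move=> z _; rewrite lee_fin sqr_ge0.
- by move=> z _; rewrite lee_fin sqr_ge0.
rewrite (coupling_fst cq (ms a)); last by move=> z; rewrite lee_fin sqr_ge0.
rewrite (coupling_snd cq (ms b)); last by move=> z; rewrite lee_fin sqr_ge0.
rewrite integral_probability_cst.
by rewrite !lte_add_pinfty ?ltry// lte_mul_pinfty// ?ltry.
Qed.

Lemma W2_coupling mu nu (a : R) : W2 mu nu < a ->
  exists2 q, coupling mu nu q & (cost q <= (a ^+ 2)%:E)%E.
Proof.
rewrite /W2; set I := ereal_inf _ => Ia.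
have a0 : 0 < a by apply: le_lt_trans Ia; exact: sqrtr_ge0.
have I0 : (0 <= I)%E by apply: le_ereal_inf_tmp => _ [q' _ <-]; exact: cost_ge0.
have [q0 cq0 q0y] := product_coupling mu nu.
have Iy : (I < +oo)%E.
  by apply: le_lt_trans q0y; apply: ereal_inf_lbound; exists q0.
have Ifin : I \is a fin_num by rewrite ge0_fin_numE.
have : (I < (a ^+ 2)%:E)%E.
  rewrite -(fineK Ifin) lte_fin -(sqr_sqrtr (fine_ge0 I0)).
  by rewrite ltrXn2r// ?nnegrE ?sqrtr_ge0 ?(ltW a0).
by move=> /ereal_inf_lt[_ [q cq <-] qa]; exists q => //; exact: ltW.
Qed.

(** The diagonal coupling has cost 0. This handles the ends of the geodesics of [CDe], which are
    prescribed up to [eq_P2] only. *)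
Lemma eq_P2_W2 mu nu : eq_P2 mu nu -> W2 mu nu = 0.
Proof.
move=> E; apply/eqP; rewrite eq_le W2_ge0 andbT.
have md : measurable_fun setT (fun x : borel X => (x, x)).
  by apply: measurable_fun_pair; exact: measurable_id.
have [q qE qi] := probability_pushforward (P2_prob mu) md.
apply: (@W2_le _ _ q) => //.
  move=> A mA; rewrite !qE; split.
    by congr (P2_prob mu _); apply/seteqP; split => [x []|x].
  by rewrite -(E A mA); congr (P2_prob mu _); apply/seteqP; split => [x []|x].
rewrite expr0n /= /cost qi; [|exact: measurable_sqr_mdist|].
  by rewrite integral0_eq// => x _; rewrite mdistxx expr0n.
by move=> z; rewrite lee_fin sqr_ge0.
Qed.

Lemma W2_refl mu : W2 mu mu = 0.
Proof. by apply: eq_P2_W2 => A. Qed.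

Lemma W2_sym_le mu nu : W2 nu mu <= W2 mu nu.
Proof.
apply/ler_addgt0Pr => e e0.
have [q cq qa] : exists2 q, coupling mu nu q & (cost q <= ((W2 mu nu + e) ^+ 2)%:E)%E.
  by apply: W2_coupling; rewrite ltrDl.
have [r rE ri] := probability_pushforward q (@measurable_swap _ _ (borel X) (borel X)).
apply: (@W2_le _ _ r).
- move=> A mA; have [q1 q2] := cq A mA; rewrite !rE; split.
    by rewrite -q2; congr (q _); apply/seteqP; split => z [].
  by rewrite -q1; congr (q _); apply/seteqP; split => z [].
- by rewrite addr_ge0 ?W2_ge0// ltW.
- rewrite /cost ri; [|exact: measurable_sqr_mdist|].
    apply: le_trans qa; rewrite /cost le_eqVlt; apply/orP; left; apply/eqP.
    by apply: eq_integral => z _; rewrite /= metric_sym.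
  by move=> z; rewrite lee_fin sqr_ge0.
Qed.

Lemma W2_sym mu nu : W2 mu nu = W2 nu mu.
Proof. by apply/eqP; rewrite eq_le !W2_sym_le. Qed.

Lemma small_partition (e : R) : 0 < e -> exists A : nat -> set (borel X),
  [/\ forall i, measurable (A i), trivIset setT A, \bigcup_i A i = setT &
    forall i (x y : X), A i x -> A i y -> mdist x y < e].
Proof.
move=> e0; have [c Hc] := separable_seq.
have e2 : 0 < e / 2 by rewrite divr_gt0.
pose B i : set (borel X) := [set y : X | mdist (c i) y < e / 2].
have mB i : measurable (B i) by apply: sub_sigma_algebra; exact: open_mdist_lt.
exists (seqDU B); split.
- by move=> i; apply: measurableD => //; apply: bigsetU_measurable => j _; exact: mB.
- exact: trivIset_seqDU.
- rewrite -seqDU_bigcup_eq; apply/seteqP; split => // x _.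
  by have [i ci] := Hc x _ e2; exists i.
- move=> i x y [Bx _] [By _]; move: Bx By; rewrite /B /= => Bx By.
  have := metric_triangle x (c i) y; rewrite (metric_sym x (c i)); lra.
Qed.

(** Under the glued measure the two middle coordinates need not coincide, but almost surely they
    share a cell, hence are less than e apart. The law of the outer coordinates couples [mu] and
    [la]. *)
Lemma W2_triangle nu mu la : W2 mu la <= W2 mu nu + W2 nu la.
Proof.
apply/ler_addgt0Pr => e' e'0.
(* Three losses: two couplings that are only nearly optimal, and the diameter of the cells. *)
pose e := e' / 3; have e0 : 0 < e by rewrite divr_gt0.
pose al := W2 mu nu + e; pose be := W2 nu la + e.
have al0 : 0 < al by rewrite ltr_wpDl ?W2_ge0.
have be0 : 0 < be by rewrite ltr_wpDl ?W2_ge0.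
have [p cp pa] : exists2 p, coupling mu nu p & (cost p <= (al ^+ 2)%:E)%E.
  by apply: W2_coupling; rewrite ltrDl.
have [q cq qb] : exists2 q, coupling nu la q & (cost q <= (be ^+ 2)%:E)%E.
  by apply: W2_coupling; rewrite ltrDl.
have [A [mA tA UA dA]] := small_partition e0.
have pqA i : p (setT `*` A i) = q (A i `*` setT).
  by have [_ ->] := cp _ (mA i); have [-> _] := cq _ (mA i).
have [P [P1 P2' PN]] := gluing_on_partition mA tA UA pqA.
have mf : measurable_fun setT
    (fun z : (borel X * borel X) * (borel X * borel X) => (z.1.1, z.2.2)).
  apply: measurable_fun_pair.
    exact: (measurableT_comp measurable_fst measurable_fst).
  exact: (measurableT_comp measurable_snd measurable_snd).
have [r rE ri] := probability_pushforward P mf.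
pose S := al + be + e.
have S0 : 0 < S by rewrite /S addr_gt0// addr_gt0.
have -> : W2 mu nu + W2 nu la + e' = S by rewrite /S /al /be /e; field.
apply: (@W2_le _ _ r) => [B mB| |]; last 2 first.
- exact: ltW.
- pose f1 (z : (borel X * borel X) * (borel X * borel X)) :=
    (mdist (z.1.1 : X) (z.1.2 : X) ^+ 2)%:E.
  pose f2 (z : (borel X * borel X) * (borel X * borel X)) :=
    (mdist (z.2.1 : X) (z.2.2 : X) ^+ 2)%:E.
  have mf1 : measurable_fun setT f1.
    exact: (measurableT_comp measurable_sqr_mdist measurable_fst).
  have mf2 : measurable_fun setT f2.
    exact: (measurableT_comp measurable_sqr_mdist measurable_snd).
  have f10 z : (0 <= f1 z)%E by rewrite lee_fin sqr_ge0.
  have f20 z : (0 <= f2 z)%E by rewrite lee_fin sqr_ge0.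
  have Sal : (0 <= (S / al)%:E)%E by rewrite lee_fin divr_ge0// ltW.
  have Sbe : (0 <= (S / be)%:E)%E by rewrite lee_fin divr_ge0// ltW.
  have Se : (0 <= (S * e)%:E)%E by rewrite lee_fin mulr_ge0// ltW.
  rewrite /cost ri; [|exact: measurable_sqr_mdist|by move=> z; rewrite lee_fin sqr_ge0].
  apply: (@le_trans _ _ (\int[P]_z ((S / al)%:E * f1 z + ((S / be)%:E * f2 z + (S * e)%:E)))%E).
    apply: ae_ge0_le_integral => //.
    + by move=> z _; rewrite lee_fin sqr_ge0.
    + exact: (measurableT_comp measurable_sqr_mdist mf).
    + by move=> z _; rewrite !adde_ge0 ?mule_ge0.
    + apply: emeasurable_funD; first exact: measurable_funeM.
      by apply: emeasurable_funD; [exact: measurable_funeM|exact: measurable_cst].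
    + case: PN => M [mM M0 NM]; exists M; split => //.
      apply: subset_trans NM => z /=; apply: contra_notP => /existsNP[i].
      move=> /contrapT[A1 A2] _; rewrite -!EFinM -!EFinD lee_fin.
      have d12 := dA i _ _ A1 A2.
      have t1 := metric_triangle (z.1.1 : X) z.1.2 z.2.2.
      have t2 := metric_triangle (z.1.2 : X) z.2.1 z.2.2.
      apply: le_trans (sqr_sum3_le _ _ al0 be0 e0).
      have t3 : mdist (z.1.1 : X) z.2.2 <= mdist (z.1.1 : X) z.1.2 + mdist (z.2.1 : X) z.2.2 + e.
        by move: t1 t2 d12; clear; lra.
      by rewrite lerXn2r ?nnegrE ?addr_ge0 ?mdist_ge0 ?(ltW e0).
  have I1 : (\int[P]_z f1 z = cost p)%E.
    rewrite (integral_marginal (Q := p) measurable_fst _ measurable_sqr_mdist)//.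
      move=> E mE; rewrite -P1//; congr (P _).
      by apply/seteqP; split => [x|x []].
    by move=> z; rewrite lee_fin sqr_ge0.
  have I2 : (\int[P]_z f2 z = cost q)%E.
    rewrite (integral_marginal (Q := q) measurable_snd _ measurable_sqr_mdist)//.
      move=> E mE; rewrite -P2'//; congr (P _).
      by apply/seteqP; split => [x|x []].
    by move=> z; rewrite lee_fin sqr_ge0.
  rewrite ge0_integralD//; last 4 first.
  + by move=> z _; rewrite mule_ge0.
  + exact: measurable_funeM.
  + by move=> z _; rewrite adde_ge0 ?mule_ge0.
  + by apply: emeasurable_funD; [exact: measurable_funeM|exact: measurable_cst].
  rewrite ge0_integralD//; last 2 first.
  + by move=> z _; rewrite mule_ge0.
  + exact: measurable_funeM.
  rewrite !ge0_integralZl// integral_probability_cst I1 I2.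
  apply: (@le_trans _ _ ((S / al)%:E * (al ^+ 2)%:E +
      ((S / be)%:E * (be ^+ 2)%:E + (S * e)%:E))%E).
    by apply: leeD; [exact: lee_wpmul2l|apply: leeD => //; exact: lee_wpmul2l].
  rewrite -!EFinM -!EFinD lee_fin le_eqVlt; apply/orP; left; apply/eqP.
  by rewrite /S; field; rewrite !gt_eqF.
- rewrite !rE; split.
    have [<- _] := cp B mB; rewrite -P1; last exact: measurableX.
    by congr (P _); apply/seteqP; split => [[[? ?] [? ?]] []|[[? ?] [? ?]] [[]]].
  have [_ <-] := cq B mB; rewrite -P2'; last exact: measurableX.
  by congr (P _); apply/seteqP; split => [[[? ?] [? ?]] []|[[? ?] [? ?]] [_ []]].
Qed.

End wasserstein_pseudometric.

(** * Heat flow *)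

Section heat_flow.
Context {R : realType} {X : completeMetricType R}.
Variables (K N : R) (m : {measure set (borel X) -> \bar R}).

(* Agrees with [U_] on [P2star], and is positive everywhere. *)
Definition Ureal (mu : P2 X) : R := expR (- (N^-1 * fine (Ent m mu))).

Lemma UrealE mu : P2star m mu -> U_ m N mu = (Ureal mu)%:E.
Proof. by move=> fmu; rewrite /U_ -(fineK fmu) -EFinM -EFinN. Qed.

Lemma evi_flow_of_EVI_flow mu gam : EVI_flow_from K N m mu gam ->
  evi_flow (@W2 R X) (P2star m) Ureal K N 0 mu gam.
Proof.
move=> [ac dom start ineq]; split => //.
- move=> e e0; have /cvgrPdist_lt /(_ e e0) := start.
  rewrite /at_right /within /= => -[n /= n0 Hn]; exists n => // t t0.
  rewrite add0r => tn; have := Hn t; rewrite /= !sub0r !normrN (gtr0_norm t0) => /(_ tn t0).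
  by rewrite ger0_norm// W2_ge0.
- move=> nu Pnu; case: (ineq nu Pnu) => A [mA A0 badA]; exists A; split => //.
  apply: subset_trans badA => t /=; apply: contra_not => Ht t0.
  have [dt le] := Ht t0; split => //; rewrite -lee_fin; apply: le_trans le _.
  rewrite !UrealE//; last exact: dom.
  by rewrite inver gt_eqF ?expR_gt0// -EFinM -EFinB -EFinM.
Qed.

Lemma CDe_geodesic mu nu : @separable R X -> CDe K N m ->
  P2star m mu -> P2star m nu ->
  exists g : R -> P2 X, [/\ W2 (g 0) mu = 0, W2 (g 1) nu = 0 &
    forall s t, 0 <= s <= 1 -> 0 <= t <= 1 ->
      W2 (g s) (g t) = `|t - s| * W2 (g 0) (g 1)].
Proof.
move=> sepX cd Pmu Pnu; have [g [[g0 g1] _ gd _]] := cd mu nu Pmu Pnu.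
by exists g; split => //; apply: eq_P2_W2.
Qed.

End heat_flow.

Lemma expdiv_avgE {R : realType} (K r : R) : 0 < r ->
  expdiv_avg K r = expdiv (K * r) 1.
Proof.
move=> r0; rewrite /expdiv_avg /expdiv mulf_eq0 (gt_eqF r0) orbF.
by case: ifP => // _; rewrite mulr1 mulNr.
Qed.

Theorem theorem3 (R : realType) (K N : R) (N_gt0 : 0 < N)
    (X : completeMetricType R) (m : {measure set (borel X) -> \bar R})
    (H : R -> P2 X -> P2 X) :
  RCDstar K N m -> is_heat_flow K N m H ->
  forall mu nu : P2 X,
    (forall s t : R, 0 < s -> 0 < t ->
      s_ (K / N) (2^-1 * W2 (H t mu) (H s nu)) ^+ 2 <=
        expR (- K * (s + t)) * s_ (K / N) (2^-1 * W2 mu nu) ^+ 2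
        + N * expdiv K (s + t)
          * ((Num.sqrt t - Num.sqrt s) ^+ 2 / (2 * (s + t)))
      /\
      W2 (H t mu) (H s nu) ^+ 2 <=
        expR (- K * tau_ s t) * W2 mu nu ^+ 2
        + 2 * N * expdiv_avg K (tau_ s t) * (Num.sqrt t - Num.sqrt s) ^+ 2)
    /\
    (forall t : R, 0 < t ->
      W2 (H t mu) (H t nu) <= expR (- K * t) * W2 mu nu).
Proof.
move=> [[sepX _ _] _ _ cd] heat mu nu.
have flow rho := evi_flow_of_EVI_flow (heat rho).
have Upos rho : 0 < Ureal N m rho by exact: expR_gt0.
have flows rho : exists x, evi_flow (@W2 R X) (P2star m) (Ureal N m) K N 0 rho x.
  by exists (fun t => H t rho).
have geod p q := @CDe_geodesic R X K N m p q sepX cd.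
have tri := @W2_triangle R X sepX.
have sym := @W2_sym R X sepX.
have tau_gt0 (s t : R) : 0 < s -> 0 < t -> 0 < tau_ s t.
  by move=> s0 t0; rewrite /tau_ mulr_gt0 ?divr_gt0// !addr_gt0// sqrtr_gt0 mulr_gt0.
have tauE (s t : R) : 0 < t ->
    2 / 3 * (t + Num.sqrt t * Num.sqrt s + s) = tau_ s t.
  by move=> t0; rewrite /tau_ sqrtrM// ltW.
have dist (s t : R) : 0 < s -> 0 < t -> W2 (H t mu) (H s nu) ^+ 2 <=
    expR (- K * tau_ s t) * W2 mu nu ^+ 2
    + 2 * N * expdiv_avg K (tau_ s t) * (Num.sqrt t - Num.sqrt s) ^+ 2.
  move=> s0 t0.
  have := evi_contraction_dist (@W2_ge0 R X) (@W2_refl R X sepX) sym tri Upos N_gt0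
    geod flows (flow mu) (flow nu) t0 s0.
  rewrite tauE// -expdiv_avgE; last exact: tau_gt0.
  by rewrite mulNr [_ * expdiv_avg _ _]mulrAC.
split=> [s t s0 t0|t t0].
  split; last exact: dist.
  have := evi_contraction (@W2_ge0 R X) (@W2_refl R X sepX) sym tri Upos N_gt0
    (flow mu) (flow nu) t0 s0.
  by rewrite !add0r [t + s]addrC.
(* For equal times the second term vanishes and [tau_] is 2 t, so both sides become squares of
   nonnegative numbers. *)
have := dist t t t0 t0; rewrite subrr expr0n /= mulr0 addr0.
have -> : tau_ t t = 2 * t.
  by rewrite /tau_ -expr2 sqrtr_sqr gtr0_norm//; field.
rewrite (_ : - K * (2 * t) = - K * t + - K * t); last by ring.
rewrite expRD -expr2 -exprMn ler_sqr ?nnegrE ?W2_ge0 ?mulr_ge0 ?W2_ge0 ?expR_ge0//.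
Qed.
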